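(* Let $\mathcal O$, $K$, $k$, $\nu$, $\pi$ be as in the context. Let $D\in\mathcal O[X]$ have degree $4$ with leading coefficient a unit of $\mathcal O$ that is a square in $K$, and let $\sqrt D\in\mathcal O((X^{-1}))$ be a square root, with reduction $\overline{\sqrt D}=\sqrt{\bar D}$. Suppose that the continued fraction of $\sqrt D$ over $K$ is not periodic, while the continued fraction of $\sqrt{\bar D}$ over $k$ is periodic with quasi-period length $\ell$. Let $\alpha_n,a_n,(p_n,q_n)$ be the complete quotients, partial quotients and canonical convergents of $\sqrt D$ over $K$. Put $\theta_{-1}=1$ and $\theta_n=\pi^{-\nu(q_n)}(p_n-\sqrt D\,q_n)$ for $n\ge0$, and $f_n=\nu(\mathrm{LC}(\theta_{n-1}))$ for $n\ge0$. Define $F_0=0$ and $F_n=-(F_{n-1}+f_n)$ for $n\ge1$. Then: (1) The complete quotients $\alpha_n$ with $\nu(\alpha_n)=-\infty$ are exactly those with $n\in U=\{j(\ell+1)-1: j\ge1\}$. (2) $f_n\ge0$ for all $n\ge0$, and $f_n>0$ if and only if $n\in U$. (3) For all $n\ge0$: $\nu(q_n)=2F_n$ and $\nu(\mathrm{LC}(q_n))=\nu(q_n)+f_n$; for all $n\ge2$: $\nu(a_n)=2(F_{n-2}+F_n)$ and $\nu(\mathrm{LC}(a_n))=\nu(a_n)+f_{n-1}+f_n$.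
   Context: $\mathcal O$ is a discrete valuation ring with fraction field $K$, uniformiser $\pi$, valuation $\nu$ (normalised with $\nu(\pi)=1$), and residue field $k$ of characteristic $\neq2$; bars denote reduction modulo the maximal ideal, applied coefficientwise to polynomials and Laurent series with coefficients in $\mathcal O$. Laurent series are elements $\sum_{n\le N}u_nX^n$ of $K((X^{-1}))$, with $\operatorname{ord}(\sum_{n\le N}u_nX^n)=-N$ if $u_N\ne0$; for such $u$, $\nu(u)=\inf_n\nu(u_n)\in\mathbb Z\cup\{\pm\infty\}$ (Gauss valuation; for a polynomial, the minimum of the valuations of its coefficients), and $\mathrm{LC}(u)$ is its leading coefficient. For $\alpha\in F((X^{-1}))$ ($F$ a field), $\lfloor\alpha\rfloor$ is the unique polynomial with $\operatorname{ord}(\alpha-\lfloor\alpha\rfloor)>0$; the continued fraction has complete quotients $\alpha_0=\alpha$, $\alpha_{n+1}=1/(\alpha_n-\lfloor\alpha_n\rfloor)$, partial quotients $a_n=\lfloor\alpha_n\rfloor$, and canonical convergents $p_{-1}=1,q_{-1}=0,p_0=a_0,q_0=1$, $p_n=a_np_{n-1}+p_{n-2}$, $q_n=a_nq_{n-1}+q_{n-2}$. It is periodic if there are $m\ge0,l\ge1$ with $a_n=a_{n+l}$ for all $n\ge m$; its quasi-period length is the minimal $l\ge1$ such that for some $m\ge0$ and $\mu\in F^*$ one has $a_n=\mu^{(-1)^n}a_{n+l}$ for all $n\ge m$. *)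

(* Defs.v *)
From HB Require Import structures.
From mathcomp Require Import all_boot all_order all_algebra.
From Stdlib Require Import ClassicalEpsilon.
Set Implicit Arguments. Unset Strict Implicit. Unset Printing Implicit Defensive.
Import Order.TTheory GRing.Theory Num.Theory.
Local Open Scope ring_scope.

(* K is the fraction field, v the (normalised) discrete valuation on   *)
(* K^*, pi a uniformiser.  v 0 is irrelevant (conventionally +oo).     *)
Record dvr (K : fieldType) (v : K -> int) (pi : K) : Prop := {
  dvr_mul : forall x y : K, x != 0 -> y != 0 -> v (x * y) = v x + v y;
  dvr_add : forall x y : K, x != 0 -> y != 0 -> x + y != 0 ->
              Order.min (v x) (v y) <= v (x + y);
  dvr_pi_neq0 : pi != 0;
  dvr_pi : v pi = 1 }.

Definition inO (K : fieldType) (v : K -> int) (x : K) : bool :=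
  (x == 0) || (0 <= v x).

(* red : O -> k is the reduction map onto the residue field k = O/m
   (only its values on O matter). *)
Record residue (K k : fieldType) (v : K -> int) (red : K -> k) : Prop := {
  red_add : forall x y, inO v x -> inO v y -> red (x + y) = red x + red y;
  red_mul : forall x y, inO v x -> inO v y -> red (x * y) = red x * red y;
  red_1 : red 1 = 1;
  red_ker : forall x, inO v x -> (red x == 0) = ((x == 0) || (0 < v x));
  red_surj : forall c : k, exists x, inO v x /\ red x = c }.

Definition nuP (K : fieldType) (v : K -> int) (p : {poly K}) : int :=
  \big[Order.min/ v (lead_coef p)]_(i < size p | p`_i != 0) v p`_i.

(* Laurent series in X^{-1}: sum_{n <= N} u_n X^n, coefficients        *)
(* indexed by int, with an upper bound ltop on the support.            *)
(* Equality of Laurent series is coefficientwise (leqL).               *)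
Record laurent (F : fieldType) := Laurent {
  lcoef : int -> F;
  ltop : int;
  ltopP : forall n : int, ltop < n -> lcoef n = 0 }.

Definition mkL (F : fieldType) (c : int -> F) (N : int) : laurent F.
Proof.
refine (@Laurent F (fun n => if N < n then 0 else c n) N _).
by move=> n Hn; rewrite Hn.
Defined.

Definition leqL (F : fieldType) (x y : laurent F) : Prop :=
  forall n, lcoef x n = lcoef y n.

Definition nneg_part (z : int) : nat :=
  match z with Posz m => m | Negz _ => 0%N end.

Definition lpoly (F : fieldType) (p : {poly F}) : laurent F :=
  mkL (fun n : int => if 0 <= n then p`_(absz n) else 0) (size p)%:Z.

Definition lone (F : fieldType) : laurent F := lpoly 1.

Definition lsub (F : fieldType) (x y : laurent F) : laurent F :=
  mkL (fun n => lcoef x n - lcoef y n) (Order.max (ltop x) (ltop y)).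

Definition lscale (F : fieldType) (c : F) (x : laurent F) : laurent F :=
  mkL (fun n => c * lcoef x n) (ltop x).

(* Cauchy product: coefficient n is sum_{i+j=n} x_i y_j, where only
   n - ltop y <= i <= ltop x can contribute. *)
Definition lmul (F : fieldType) (x y : laurent F) : laurent F :=
  mkL (fun n => \sum_(k < nneg_part (ltop x + ltop y - n + 1))
                   lcoef x (n - ltop y + k%:Z) * lcoef y (ltop y - k%:Z))
      (ltop x + ltop y).

Definition lmap (F G : fieldType) (f : F -> G) (x : laurent F) : laurent G :=
  mkL (fun n => f (lcoef x n)) (ltop x).

Definition lfloor (F : fieldType) (x : laurent F) : {poly F} :=
  \poly_(i < (absz (ltop x)).+1) lcoef x i%:Z.

Definition lead_exp (F : fieldType) (u : laurent F) (N : int) : Prop :=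
  lcoef u N != 0 /\ forall n, N < n -> lcoef u n = 0.

Definition lexp (F : fieldType) (u : laurent F) : int :=
  epsilon (inhabits 0) (lead_exp u).

Definition lcL (F : fieldType) (u : laurent F) : F := lcoef u (lexp u).

Definition nuL_minf (K : fieldType) (v : K -> int) (u : laurent K) : Prop :=
  forall m : int, exists i, lcoef u i != 0 /\ v (lcoef u i) < m.

Definition is_cf (F : fieldType) (al0 : laurent F) (al : nat -> laurent F)
    (a : nat -> {poly F}) : Prop :=
  leqL (al 0%N) al0 /\
  forall n, a n = lfloor (al n) /\
            leqL (lmul (lsub (al n) (lpoly (a n))) (al n.+1)) (lone F).

(* cvg a n = ((p_{n-2}, q_{n-2}), (p_{n-1}, q_{n-1})),
   with p_{-2} = 0, q_{-2} = 1, p_{-1} = 1, q_{-1} = 0. *)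
Fixpoint cvg (F : fieldType) (a : nat -> {poly F}) (n : nat)
  : ({poly F} * {poly F}) * ({poly F} * {poly F}) :=
  match n with
  | 0%N => ((0, 1), (1, 0))
  | n'.+1 => let: (x, y) := cvg a n' in
             (y, (a n' * y.1 + x.1, a n' * y.2 + x.2))
  end.

Definition cf_p (F : fieldType) (a : nat -> {poly F}) (n : nat) : {poly F} :=
  (cvg a n.+1).2.1.
Definition cf_q (F : fieldType) (a : nat -> {poly F}) (n : nat) : {poly F} :=
  (cvg a n.+1).2.2.

Definition cf_periodic (F : fieldType) (a : nat -> {poly F}) : Prop :=
  exists m l : nat, (1 <= l)%N /\ forall n, (m <= n)%N -> a n = a (n + l)%N.

Definition quasi_period (F : fieldType) (a : nat -> {poly F}) (l : nat) : Prop :=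
  exists (m : nat) (mu : F), mu != 0 /\
    forall n, (m <= n)%N -> a n = (if odd n then mu^-1 else mu) *: a (n + l)%N.

Definition qperiod_length (F : fieldType) (a : nat -> {poly F}) (l : nat) : Prop :=
  (1 <= l)%N /\ quasi_period a l /\
  forall l', (1 <= l')%N -> quasi_period a l' -> (l <= l')%N.

Definition inU (l n : nat) : Prop := exists j : nat, (1 <= j)%N /\ n.+1 = (j * l.+1)%N.

Definition theta (K : fieldType) (v : K -> int) (pi : K) (sD : laurent K)
    (a : nat -> {poly K}) (n : nat) : laurent K :=
  lscale (pi ^ (- nuP v (cf_q a n)))
         (lsub (lpoly (cf_p a n)) (lmul sD (lpoly (cf_q a n)))).

(* f_n = nu(LC(theta_{n-1})), theta_{-1} = 1 *)
Definition fseq (K : fieldType) (v : K -> int) (pi : K) (sD : laurent K)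
    (a : nat -> {poly K}) (n : nat) : int :=
  match n with
  | 0%N => v 1
  | n'.+1 => v (lcL (theta v pi sD a n'))
  end.

Fixpoint Fseq (K : fieldType) (v : K -> int) (pi : K) (sD : laurent K)
    (a : nat -> {poly K}) (n : nat) : int :=
  match n with
  | 0%N => 0
  | n'.+1 => - (Fseq v pi sD a n' + fseq v pi sD a n'.+1)
  end.

(* Main.v *)
Require Import Defs.
From HB Require Import structures.
From mathcomp Require Import all_boot all_order all_algebra.
From mathcomp Require Import boolp ring zify.
Set Implicit Arguments. Unset Strict Implicit. Unset Printing Implicit Defensive.
Import Order.TTheory GRing.Theory Num.Theory.
Local Open Scope ring_scope.

(** Write [al n = (r n + sqrt D) / s n].  As [D] is quartic, [r n = A + t n] with
    [A] the polynomial part of [sqrt D] and [t n] constant, [s n] has degree at most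
    [1], and [a n * s n = 2 A + t n + t n.+1], [s n.-1 * s n = D - (A + t n) ^ 2].
    A constant [s n] with [n >= 1] forces periodicity, so over [K] every such [s n]
    is linear, whereas over [k] the first constant one is [sb l].

    Modulo the maximal ideal the pairs [(s n, t n)], with [s n] taken up to scaling,
    follow the expansion over [k] for [l + 1] steps.  At [n] congruent to [l] the root
    of [s n] has a pole, of order [f n] say; then [t n.+1] has a pole of order
    [2 f n], [s n.+1] also reduces to a constant, and [t n.+1 * t n.+2 = - R z], with
    [R = D - A ^ 2] and [z] the root of [s n.+1], brings [t n.+2] back to [0] modulo
    the maximal ideal, so that the pattern starts again.  The valuations of the [s n]
    and [a n] follow.  Those of the convergents come from [p ^ 2 - D q ^ 2 = +- s],
    whose Gauss valuation is twice that of [q] because [D] is not a square over [k],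
    and from the fact that the leading coefficients of [p n.-1 - sqrt D * q n.-1]
    and [q n] are inverse up to sign. *)

(** * Laurent series as a ring *)

Section LaurentRing.
Variable F : fieldType.

Definition bounded_by (f : int -> F) (N : int) := forall n, N < n -> f n = 0.

(** The bound is hidden in an existential, so that series with the same coefficients are equal in
    the sense of Leibniz; in [laurent] the bound [ltop] is data. *)
Record lser := Lser { ser :> int -> F; serP : exists N, bounded_by ser N }.

Lemma lser_eq (x y : lser) : x =1 y -> x = y.
Proof.
case: x y => [f Hf] [g Hg] /= /funext fg; move: Hf Hg; rewrite fg => Hf Hg.
by congr Lser; exact: Prop_irrelevance.
Qed.

HB.instance Definition _ := gen_eqMixin lser.
HB.instance Definition _ := gen_choiceMixin lser.

Definition bnd (x : lser) : int := projT1 (cid (serP x)).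

Lemma bndP (x : lser) : bounded_by x (bnd x).
Proof. exact: projT2 (cid (serP x)). Qed.

(** * The Cauchy product *)

Definition csum (x y : int -> F) (N : int) (L : nat) (n : int) : F :=
  \sum_(j < L) x (N - j%:Z) * y (n - N + j%:Z).

Lemma csum_shift x y N L n d :
  bounded_by x N -> csum x y (N + d%:Z) (d + L) n = csum x y N L n.
Proof.
move=> bx; rewrite /csum big_split_ord /= big1 ?add0r; last first.
  by move=> i _; rewrite bx ?mul0r //; move: (ltn_ord i); lia.
by apply: eq_bigr => i _; congr (x _ * y _); lia.
Qed.

Lemma csum_extend x y N M L n d :
  bounded_by y M -> N + M - n < L%:Z -> csum x y N (L + d) n = csum x y N L n.
Proof.
move=> by_ lt_L; rewrite /csum big_split_ord /= [X in _ + X]big1 ?addr0 //.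
by move=> i _; rewrite [y _]by_ ?mulr0 //; lia.
Qed.

(** Raising the starting index adds only zero terms of [x], and lengthening the sum only zero terms
    of [y]. Hence the product does not depend on the bounds chosen for its factors. *)
Lemma csum_indep x y N N' M L L' n :
  bounded_by x N -> bounded_by x N' -> bounded_by y M ->
  N + M - n < L%:Z -> N' + M - n < L'%:Z -> csum x y N L n = csum x y N' L' n.
Proof.
move=> bx bx' by_; wlog le_N : N N' L L' bx bx' / N <= N' => [th|].
  case: (leP N N') => [|/ltW] le_N; first exact: th.
  by move=> ? ?; apply/esym/th.
move=> lt_L lt_L'; have -> : N' = N + (absz (N' - N)%R)%:Z by lia.
set d := (absz (N' - N)%R).
rewrite -(@csum_extend x y N M L n L' by_ lt_L) -(@csum_shift x y N (L + L') n d bx).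
rewrite (_ : d + (L + L') = L' + (d + L))%N; last by lia.
by apply: (csum_extend _ _ by_); rewrite /d; lia.
Qed.

Definition lmul_fun (x y : lser) (n : int) : F :=
  csum x y (bnd x) (absz (bnd x + bnd y - n)%R).+1 n.

Lemma lmul_funE (x y : lser) N M L n :
  bounded_by x N -> bounded_by y M -> N + M - n < L%:Z ->
  lmul_fun x y n = csum x y N L n.
Proof.
move=> bx by_ ltL; rewrite /lmul_fun.
rewrite -(@csum_extend _ _ _ (bnd y) _ n (absz (bnd x + M - n)%R).+1 (@bndP y)); last by lia.
by apply: (csum_indep (@bndP x) bx by_) => //; lia.
Qed.

Lemma lmul_fun_bounded (x y : lser) N M :
  bounded_by x N -> bounded_by y M -> bounded_by (lmul_fun x y) (N + M).
Proof.
move=> bx by_ n ltn; rewrite (lmul_funE (L := 0) bx by_) ?/csum ?big_ord0 //.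
by lia.
Qed.

(** The first [m + 1] coefficients from index [N] downwards, read as a polynomial in [X^-1].
    Commutativity and associativity of the product of series are thereby inherited from
    [{poly F}]. *)
Definition trunc (f : int -> F) (N : int) (m : nat) : {poly F} :=
  \poly_(i < m.+1) f (N - i%:Z).

Lemma coef_trunc f N m i :
  (trunc f N m)`_i = if (i <= m)%N then f (N - i%:Z) else 0.
Proof. by rewrite coef_poly ltnS. Qed.

Lemma coefM_eq_upto (p p' q q' : {poly F}) m :
  (forall i, (i <= m)%N -> p`_i = p'`_i) ->
  (forall i, (i <= m)%N -> q`_i = q'`_i) -> (p * q)`_m = (p' * q')`_m.
Proof.
move=> Ep Eq; rewrite !coefM; apply: eq_bigr => j _.
by rewrite Ep ?Eq ?leq_subr // -ltnS.
Qed.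

Lemma lmul_fun_trunc (x y : lser) N M m k : bounded_by x N -> bounded_by y M ->
  (k <= m)%N ->
  lmul_fun x y (N + M - k%:Z) = (trunc x N m * trunc y M m)`_k.
Proof.
move=> bx by_ km; rewrite (lmul_funE (L := k.+1) bx by_); last by lia.
rewrite coefM; apply: eq_bigr => j _; have := ltn_ord j => jk.
rewrite !coef_trunc ifT; last by lia.
rewrite ifT; last by lia.
by congr (_ * y _); lia.
Qed.

Definition lzero := @Lser (fun=> 0) (ex_intro _ 0 (fun _ _ => erefl)).
Definition lunit_fun (n : int) : F := (n == 0)%:R.

Lemma lunit_bounded : bounded_by lunit_fun 0.
Proof. by move=> n n0; rewrite /lunit_fun gt_eqF. Qed.

Definition lunit := Lser (ex_intro _ 0 lunit_bounded).

Lemma ladd_subproof (x y : lser) : exists N, bounded_by (fun n => x n + y n) N.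
Proof.
exists (Order.max (bnd x) (bnd y)) => n; rewrite gt_max => /andP[nx ny].
by rewrite !bndP ?addr0.
Qed.

Definition ladd x y := Lser (ladd_subproof x y).

Lemma lopp_subproof (x : lser) : exists N, bounded_by (fun n => - x n) N.
Proof. by exists (bnd x) => n nx; rewrite bndP ?oppr0. Qed.

Definition lopp x := Lser (lopp_subproof x).

Definition lmulr (x y : lser) : lser :=
  @Lser (lmul_fun x y) (ex_intro _ _ (lmul_fun_bounded (@bndP x) (@bndP y))).

Fact laddA : associative ladd.
Proof. by move=> x y z; apply: lser_eq => n /=; rewrite addrA. Qed.
Fact laddC : commutative ladd.
Proof. by move=> x y; apply: lser_eq => n /=; rewrite addrC. Qed.
Fact ladd0 : left_id lzero ladd.
Proof. by move=> x; apply: lser_eq => n /=; rewrite add0r. Qed.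
Fact laddN : left_inverse lzero lopp ladd.
Proof. by move=> x; apply: lser_eq => n /=; rewrite addNr. Qed.

HB.instance Definition _ := GRing.isZmodule.Build lser laddA laddC ladd0 laddN.

Lemma bounded_le (f : int -> F) N M : N <= M -> bounded_by f N -> bounded_by f M.
Proof. by move=> NM bf n Mn; apply: bf; apply: le_lt_trans Mn. Qed.

Fact lmulC : commutative lmulr.
Proof.
move=> x y; apply: lser_eq => n /=.
case: (ltP (bnd x + bnd y) n) => [lt_n|le_n].
  by rewrite !(lmul_fun_bounded (@bndP _) (@bndP _)) // addrC.
pose m := absz (bnd x + bnd y - n)%R.
have E1 : n = bnd x + bnd y - m%:Z by rewrite /m; lia.
have E2 : n = bnd y + bnd x - m%:Z by rewrite /m; lia.
rewrite {1}E1 E2 !(lmul_fun_trunc (@bndP _) (@bndP _) (leqnn m)).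
by rewrite mulrC.
Qed.

Fact lmulA : associative lmulr.
Proof.
move=> x y z; apply: lser_eq => n.
have [bx [by_ bz]] := (@bndP x, (@bndP y, @bndP z)).
have bxy : bounded_by (lmulr x y) (bnd x + bnd y) by exact: lmul_fun_bounded.
have byz : bounded_by (lmulr y z) (bnd y + bnd z) by exact: lmul_fun_bounded.
case: (ltP (bnd x + bnd y + bnd z) n) => [lt_n|le_n] /=.
  by rewrite (lmul_fun_bounded bxy bz) // (lmul_fun_bounded bx byz) // addrA.
pose m := absz (bnd x + bnd y + bnd z - n)%R.
have E1 : n = bnd x + (bnd y + bnd z) - m%:Z by rewrite /m; lia.
have E2 : n = bnd x + bnd y + bnd z - m%:Z by rewrite /m; lia.
rewrite {1}E1 E2 (lmul_fun_trunc bx byz (leqnn m)) (lmul_fun_trunc bxy bz (leqnn m)).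
transitivity ((trunc x (bnd x) m * (trunc y (bnd y) m * trunc z (bnd z) m))`_m).
  apply: coefM_eq_upto => // i im; rewrite coef_trunc im.
  exact: lmul_fun_trunc.
rewrite mulrA; apply: coefM_eq_upto => // i im; rewrite coef_trunc im.
by apply/esym/lmul_fun_trunc.
Qed.

Fact lmul1 : left_id lunit lmulr.
Proof.
move=> x; apply: lser_eq => n /=.
rewrite (@lmul_funE lunit x 0 (bnd x) (absz (bnd x - n)%R).+1 n lunit_bounded (@bndP x));
  last by lia.
rewrite /csum big_ord_recl big1 => [|i _] /=.
  by rewrite /lunit_fun subr0 eqxx mul1r subr0 !addr0.
by rewrite (_ : lunit_fun _ = 0) ?mul0r.
Qed.

Fact lmulDl : left_distributive lmulr ladd.
Proof.
move=> x y z; apply: lser_eq => n /=.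
set N := Order.max (bnd x) (bnd y).
have bx : bounded_by x N by apply: bounded_le (@bndP x); rewrite le_max lexx.
have by_ : bounded_by y N by apply: bounded_le (@bndP y); rewrite le_max lexx orbT.
have bxy : bounded_by (ladd x y) N.
  by move=> m Nm /=; rewrite bx ?by_ ?addr0.
have ltL : N + bnd z - n < (absz (N + bnd z - n)%R).+1%:Z by lia.
rewrite (lmul_funE bxy (@bndP z) ltL) (lmul_funE bx (@bndP z) ltL).
rewrite (lmul_funE by_ (@bndP z) ltL) /csum -big_split /=.
by apply: eq_bigr => i _; rewrite mulrDl.
Qed.

Fact lone_neq0 : lunit != 0.
Proof.
apply/eqP => /(congr1 (fun x : lser => x 0)) /=; rewrite /lunit_fun eqxx.
by move/eqP; rewrite oner_eq0.
Qed.

HB.instance Definition _ :=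
  GRing.Zmodule_isComNzRing.Build lser lmulA lmulC lmul1 lmulDl lone_neq0.

Lemma serD (x y : lser) n : (x + y) n = x n + y n. Proof. by []. Qed.
Lemma serN (x : lser) n : (- x) n = - x n. Proof. by []. Qed.
Lemma serB (x y : lser) n : (x - y) n = x n - y n. Proof. by []. Qed.
Lemma ser0 n : (0 : lser) n = 0. Proof. by []. Qed.

Lemma serM (x y : lser) N M L n :
  bounded_by x N -> bounded_by y M -> N + M - n < L%:Z ->
  (x * y) n = \sum_(j < L) x (N - j%:Z) * y (n - N + j%:Z).
Proof. exact: lmul_funE. Qed.

Lemma boundedM (x y : lser) N M :
  bounded_by x N -> bounded_by y M -> bounded_by (x * y) (N + M).
Proof. exact: lmul_fun_bounded. Qed.

Lemma boundedD (x y : lser) N :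
  bounded_by x N -> bounded_by y N -> bounded_by (x + y) N.
Proof. by move=> bx by_ n Nn; rewrite serD bx // by_ // addr0. Qed.

Lemma boundedN (x : lser) N : bounded_by x N -> bounded_by (- x) N.
Proof. by move=> bx n Nn; rewrite serN bx // oppr0. Qed.

Lemma serM_top (x y : lser) N M :
  bounded_by x N -> bounded_by y M -> (x * y) (N + M) = x N * y M.
Proof.
move=> bx by_; rewrite (serM (L := 1) bx by_); last by lia.
by rewrite big_ord1 subr0 addr0 addrAC subrr add0r.
Qed.

(** * Leading terms *)

Definition leads (x : int -> F) (N : int) (c : F) :=
  [/\ c != 0, x N = c & bounded_by x N].

Lemma leadsM (x y : lser) N M c d :
  leads x N c -> leads y M d -> leads (x * y) (N + M) (c * d).
Proof.
move=> [c0 xN bx] [d0 yM by_]; split; last exact: boundedM.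
- by rewrite mulf_neq0.
- by rewrite serM_top // xN yM.
Qed.

Lemma leads_inj (x : int -> F) N M c d : leads x N c -> leads x M d -> N = M /\ c = d.
Proof.
move=> [c0 xN bN] [d0 xM bM].
suff E : N = M by split=> //; rewrite -xN -xM E.
case: (ltgtP N M) => // [/bN|/bM] E; first by rewrite -xM E eqxx in d0.
by rewrite -xN E eqxx in c0.
Qed.

Lemma bounded_leads (x : lser) N : bounded_by x N -> x != 0 ->
  exists M c, [/\ M <= N, leads x M c & c = x M].
Proof.
move=> bx x0.
have /existsNP[n0 xn0] : ~ forall n, x n = 0.
  by move=> E; case/eqP: x0; apply: lser_eq.
have n0N : n0 <= N by case: leP => // /bx.
have ex : exists d : nat, x (N - d%:Z) != 0.
  by exists (absz (N - n0)%R); apply/eqP; rewrite (_ : N - _ = n0) //; lia.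
case: (ex_minnP ex) => d xd min_d; exists (N - d%:Z), (x (N - d%:Z)).
split=> //; first by lia.
split=> // n ltn; case: (ltP N n) => [/bx //|nN].
apply/eqP; apply: contraTT isT => xn.
have := min_d (absz (N - n)%R); rewrite (_ : N - _ = n); last by lia.
by move=> /(_ xn); lia.
Qed.

Lemma neq0_leads (x : lser) : x != 0 -> exists M c, leads x M c.
Proof. by move/(bounded_leads (@bndP x)) => [M [c [_ ? _]]]; exists M, c. Qed.

Lemma lser_mul_eq0 (x y : lser) : x * y = 0 -> x != 0 -> y = 0.
Proof.
move=> xy x0; apply/eqP; apply: contraTT isT => y0.
have [N [c lx]] := neq0_leads x0; have [M [d ly]] := neq0_leads y0.
by have [+ /esym/eqP] := leadsM lx ly; rewrite xy ser0 => /negPf->.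
Qed.

Lemma lser_mulI (x y z : lser) : x != 0 -> x * y = x * z -> y = z.
Proof.
move=> x0 /eqP; rewrite -subr_eq0 -mulrBr => /eqP /lser_mul_eq0 /(_ x0) /eqP.
by rewrite subr_eq0 => /eqP.
Qed.

(** * Polynomials as series *)

Definition pser_fun (p : {poly F}) (n : int) : F := if 0 <= n then p`_`|n| else 0.

Lemma pser_bounded (p : {poly F}) (N : nat) :
  (size p <= N.+1)%N -> bounded_by (pser_fun p) N%:Z.
Proof.
move=> sp [n|n] //= ltn; rewrite /pser_fun /= nth_default //.
by apply: leq_trans sp _.
Qed.

Definition pser (p : {poly F}) : lser :=
  Lser (ex_intro _ _ (@pser_bounded p (size p) (leqnSn _))).

Lemma pserE p (i : nat) : pser p i%:Z = p`_i. Proof. by []. Qed.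

Lemma pser_neg p (n : int) : n < 0 -> pser p n = 0.
Proof. by move=> n0 /=; rewrite /pser_fun; case: leP n0. Qed.

Lemma pserB : {morph pser : p q / p - q}.
Proof.
by move=> p q; apply: lser_eq => n /=; rewrite /pser_fun; case: ifP; rewrite ?subr0 // coefB.
Qed.

HB.instance Definition _ := GRing.isZmodMorphism.Build {poly F} lser pser pserB.

Lemma pserD : {morph pser : p q / p + q}. Proof. exact: raddfD. Qed.

Lemma pserC_mul c (x : lser) n : (pser c%:P * x) n = c * x n.
Proof.
have bc : bounded_by (pser c%:P) 0 by apply: (@pser_bounded _ 0); rewrite size_polyC; case: eqP.
rewrite (serM (L := (absz (bnd x - n)%R).+1) bc (@bndP x)); last by lia.
rewrite big_ord_recl big1 ?addr0 ?subr0 ?pserE ?coefC //.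
by move=> i _; rewrite pser_neg ?mul0r // sub0r oppr_lt0.
Qed.

Lemma pserX_mul (x : lser) n : (pser 'X * x) n = x (n - 1).
Proof.
have bX : bounded_by (pser 'X) 1 by apply: (@pser_bounded _ 1); rewrite size_polyX.
rewrite (serM (L := (absz (1 + bnd x - n)%R).+1) bX (@bndP x)); last by lia.
rewrite big_ord_recl subr0 addr0 (pserE _ 1) coefX mul1r big1 ?addr0 // => i _.
rewrite (_ : 1 - _ = - i%:Z); last by rewrite lift0; lia.
case: i => [[|i] ?]; last by rewrite pser_neg ?mul0r.
by rewrite (_ : pser _ _ = 0) ?mul0r //= /pser_fun /= coefX.
Qed.

Lemma pserM : {morph pser : p q / p * q}.
Proof.
move=> p q; elim/poly_ind: p => [|p c IH]; first by rewrite mul0r raddf0 mul0r.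
have HX r : pser (r * 'X) = pser 'X * pser r.
  apply: lser_eq => -[[|n]|n]; rewrite pserX_mul.
  - by rewrite (pserE _ 0) coefMX pser_neg.
  - by rewrite pserE coefMX (_ : _ - 1 = n%:Z) ?pserE //; lia.
  - by rewrite !pser_neg //; lia.
have HC r : pser (c%:P * r) = pser c%:P * pser r.
  apply: lser_eq => n; rewrite pserC_mul /= /pser_fun coefCM.
  by case: ifP; rewrite ?mulr0.
rewrite mulrDl mulrAC !raddfD /= mulrDl; congr (_ + _); last exact: HC.
by rewrite !HX IH mulrA.
Qed.

Lemma pser1 : pser 1 = 1.
Proof.
apply: lser_eq => n /=; rewrite /pser_fun coef1 /lunit_fun.
by case: n => [[|n]|n].
Qed.

HB.instance Definition _ :=
  GRing.isMonoidMorphism.Build {poly F} lser pser (pser1, pserM).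

Lemma pser_inj : injective pser.
Proof.
move=> p q E; apply/polyP => i.
by have := congr1 (fun x : lser => x i%:Z) E; rewrite !pserE.
Qed.

Lemma pser_eq0 p : (pser p == 0) = (p == 0).
Proof. by rewrite -(rmorph0 pser) (inj_eq pser_inj). Qed.

Lemma leads_pser p : p != 0 -> leads (pser p) (size p).-1%:Z (lead_coef p).
Proof.
by move=> p0; split; rewrite ?lead_coef_eq0 //; apply: pser_bounded; apply: leqSpred.
Qed.

(** * Translation of the series of the statement *)

Definition ls (x : laurent F) : lser :=
  @Lser (lcoef x) (ex_intro _ (ltop x) (@ltopP F x)).

Lemma leqL_ls x y : leqL x y <-> ls x = ls y.
Proof.
split=> [E|E n]; first by apply: lser_eq.
by have := congr1 (fun x : lser => x n) E.
Qed.

Lemma ls_lpoly p : ls (lpoly p) = pser p.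
Proof.
apply: lser_eq => n /=; case: ifP => // ltn.
by rewrite (@pser_bounded p (size p)).
Qed.

Lemma ls_lsub x y : ls (lsub x y) = ls x - ls y.
Proof.
apply: lser_eq => n /=; case: ifP => //; rewrite gt_max => /andP[? ?].
by rewrite !ltopP // subr0.
Qed.

Lemma ls_lone : ls (lone F) = 1. Proof. by rewrite ls_lpoly pser1. Qed.

Lemma ls_lscale c x : ls (lscale c x) = pser c%:P * ls x.
Proof.
apply: lser_eq => n; rewrite pserC_mul /=; case: ifP => // ?.
by rewrite ltopP // mulr0.
Qed.

Lemma ls_lmul x y : ls (lmul x y) = ls x * ls y.
Proof.
(* The sum in [lmul] runs down the second factor from its top, while [serM] runs down the first;
   hence the exchange of factors. *)
rewrite [RHS]mulrC; apply: lser_eq => n.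
rewrite -[LHS]/(if ltop x + ltop y < n then 0 else _).
have bx : bounded_by (ls x) (ltop x) by exact: ltopP.
have by_ : bounded_by (ls y) (ltop y) by exact: ltopP.
case: ifP => [lt_n|]; first by rewrite (boundedM by_ bx) // addrC.
move=> /negbT; rewrite -leNgt => le_n.
set L := nneg_part _.
have EL : L%:Z = ltop x + ltop y - n + 1.
  by rewrite /L; case E : (_ + 1) => [m|m] //; lia.
rewrite (serM (L := L) by_ bx); last by lia.
by apply: eq_bigr => j _; rewrite mulrC.
Qed.

Lemma lfloorE (x : laurent F) (i : nat) : (lfloor x)`_i = lcoef x i%:Z.
Proof.
rewrite /lfloor coef_poly; case: ltnP => // ltn.
by rewrite ltopP //; lia.
Qed.

(** [lexp] is chosen by [epsilon]; uniqueness of the leading exponent pins the choice down. *)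
Lemma leads_lcL (x : laurent F) N c : leads (ls x) N c -> lcL x = c.
Proof.
move=> lx; have [c0 xN bx] := lx.
have : exists M, lead_exp x M by exists N; split; rewrite // -[lcoef x N]/(ls x N) xN.
move/(ClassicalEpsilon.epsilon_spec (inhabits 0)); rewrite -/(lexp x) => -[l0 lb].
by have [_ ->] := leads_inj lx (And3 l0 erefl lb).
Qed.

End LaurentRing.

(** * Complete quotients of a quartic square root *)

Section CompleteQuotients.
Variables (F : fieldType) (D : {poly F}) (sD : lser F).
Variables (al : nat -> lser F) (a : nat -> {poly F}).
Hypothesis sD_sqr : sD * sD = pser D.
Hypothesis al_0 : al 0%N = sD.
Hypothesis a_floor : forall n (i : nat), (a n)`_i = al n i%:Z.
Hypothesis al_step : forall n, (al n - pser (a n)) * al n.+1 = 1.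

(* [rsu n = (r_n, s_n, s_{n-1})] with [al n = (r_n + sqrt D) / s_n]. *)
Fixpoint rsu (n : nat) : {poly F} * {poly F} * {poly F} :=
  if n is n'.+1 then
    let: (r, s, u) := rsu n' in
    (a n' * s - r, u + a n' * (r - (a n' * s - r)), s)
  else (0, 1, D).

Definition cq_r n := (rsu n).1.1.
Definition cq_s n := (rsu n).1.2.
(** For quartic [D] and [n >= 1] this is the constant by which [r_n] differs from the polynomial
    part [a 0] of the root. At [0] it has no such meaning, since [r_0 = 0]. *)
Definition cq_t n := (cq_r n - a 0%N)`_0.

Lemma cq_rS n : cq_r n.+1 = a n * cq_s n - cq_r n.
Proof. by rewrite /cq_r /cq_s /=; case: (rsu n) => [[r s] u]. Qed.

Lemma cq_uS n : (rsu n.+1).2 = cq_s n.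
Proof. by rewrite /cq_s /=; case: (rsu n) => [[r s] u]. Qed.

Lemma cq_sS n :
  cq_s n.+1 = (rsu n).2 + a n * (cq_r n - cq_r n.+1).
Proof. by rewrite /cq_r /cq_s /=; case: (rsu n) => [[r s] u]. Qed.

(** The recursion in [rsu] avoids division. This invariant shows that it agrees with the classical
    formula [s_{n+1} = (D - r_{n+1}^2) / s_n]. *)
Lemma cq_norm_u n : cq_r n ^+ 2 + cq_s n * (rsu n).2 = D.
Proof.
elim: n => [|n IH]; first by rewrite /cq_r /cq_s /=; ring.
by rewrite cq_uS cq_sS -[RHS]IH cq_rS; ring.
Qed.

Lemma cq_norm n : cq_s n * cq_s n.+1 = D - cq_r n.+1 ^+ 2.
Proof. by have := cq_norm_u n.+1; rewrite cq_uS => <-; ring. Qed.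

(** A polynomial root would have zero fractional part, against [al_step 0]. *)
Lemma sqrt_not_poly p : sD != pser p.
Proof.
apply/eqP => E; have := al_step 0; rewrite al_0 (_ : pser (a 0%N) = sD).
  by rewrite subrr mul0r => /eqP; rewrite eq_sym oner_eq0.
by rewrite E; congr pser; apply/polyP => i; rewrite a_floor al_0 E pserE.
Qed.

Lemma not_square p : D != p ^+ 2.
Proof.
apply/eqP => E; have : (sD - pser p) * (sD + pser p) = 0.
  rewrite -subr_sqr expr2 sD_sqr E rmorphXn /=; exact: subrr.
move/lser_mul_eq0; rewrite subr_eq0 sqrt_not_poly => /(_ isT) /eqP.
by rewrite addr_eq0 -rmorphN /= (negPf (sqrt_not_poly _)).
Qed.

(** Since [q ^ 2] would divide [p ^ 2], [q] would divide [p], and [D] would be the square of a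
    polynomial. Over [k] this forbids cancellation in [p ^ 2 - D q ^ 2]. *)
Lemma not_ratio_square p q : q != 0 -> p ^+ 2 != D * q ^+ 2.
Proof.
move=> q0; apply/eqP => E.
have /dvdpP[w Ep] : q %| p by rewrite -(@dvdp_pexp2r _ _ _ 2) // E dvdp_mull.
have /eqP := not_square w; apply; apply: (mulIf (expf_neq0 2 q0)).
by rewrite -E Ep exprMn.
Qed.

(** The two claims support each other: the formula at [n.+1] is obtained by cancelling [s_n], and a
    vanishing [s_{n+1}] would turn that formula into a polynomial value of [sqrt D]. *)
Lemma cq_al_s n : cq_s n != 0 /\ pser (cq_s n) * al n = sD + pser (cq_r n).
Proof.
elim: n => [|n [s0 IH]].
  by rewrite /cq_s /cq_r /= oner_eq0 rmorph1 mul1r raddf0 addr0 al_0.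
have Hr : (sD - pser (cq_r n.+1)) * al n.+1 = pser (cq_s n).
  transitivity (pser (cq_s n) * ((al n - pser (a n)) * al n.+1)).
    have -> : sD = pser (cq_s n) * al n - pser (cq_r n) by rewrite IH addrK.
    by rewrite cq_rS pserB pserM; ring.
  by rewrite al_step mulr1.
have s0' : pser (cq_s n) != 0 by rewrite pser_eq0.
have Es : pser (cq_s n.+1) * al n.+1 = sD + pser (cq_r n.+1).
  apply: (lser_mulI s0'); rewrite mulrA -pserM cq_norm pserB -sD_sqr -Hr.
  by rewrite expr2 pserM; ring.
split=> //; apply/eqP => E; move: Es; rewrite E raddf0 mul0r => /esym/eqP.
by rewrite addr_eq0 -rmorphN /= (negPf (sqrt_not_poly _)).
Qed.

Lemma cq_s_neq0 n : cq_s n != 0. Proof. by case: (cq_al_s n). Qed.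

Lemma cq_al n : pser (cq_s n) * al n = sD + pser (cq_r n).
Proof. by case: (cq_al_s n). Qed.

Lemma cq_al_conj n : (sD - pser (cq_r n.+1)) * al n.+1 = pser (cq_s n).
Proof.
have s0 : sD + pser (cq_r n.+1) != 0.
  by rewrite addr_eq0 -rmorphN /= sqrt_not_poly.
apply: (lser_mulI s0); rewrite mulrA [_ * (sD - _)]mulrC -subr_sqr expr2 sD_sqr.
rewrite -cq_al -rmorphXn /= -pserB -cq_norm pserM; ring.
Qed.

Lemma fracpart_bounded n : bounded_by (al n - pser (a n)) (-1).
Proof.
move=> [i|i] lti; last by lia.
by rewrite serB pserE a_floor subrr.
Qed.

Lemma leads_one : leads (1 : lser F) 0 1.
Proof. by split; [exact: oner_neq0| |exact: lunit_bounded]. Qed.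

(** The fractional part has negative degree, so its inverse [al n.+1] has positive degree and shares
    its leading term with its polynomial part. *)
Lemma leads_al n : exists2 N : nat, (1 <= N)%N &
  leads (al n.+1) N%:Z (lead_coef (a n.+1)) /\ size (a n.+1) = N.+1.
Proof.
have x0 : al n - pser (a n) != 0.
  by apply/eqP => E; have /esym/eqP := al_step n; rewrite E mul0r oner_eq0.
have y0 : al n.+1 != 0.
  by apply/eqP => E; have /esym/eqP := al_step n; rewrite E mulr0 oner_eq0.
have [M [c [leM lx _]]] := bounded_leads (@fracpart_bounded n) x0.
have [N [d ly]] := neq0_leads y0.
have := leadsM lx ly; rewrite al_step => /(leads_inj leads_one)[E _].
have [d0 yN by_] := ly; case: N => [N|N] in E ly yN by_ *; last by lia.
have sz : size (a n.+1) = N.+1.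
  apply/eqP; rewrite eqn_leq; apply/andP; split.
    by apply/leq_sizeP => j ltj; rewrite a_floor by_.
  by rewrite ltnNge; apply: contra d0 => /leq_sizeP/(_ N (leqnn _)); rewrite a_floor yN => ->.
exists N; first by lia.
by split=> //; rewrite lead_coefE sz /= a_floor yN.
Qed.

(** * Norms and errors of the convergents *)

Lemma convergent_norm n : let: (P, Q) := (cvg a n).2 in
  P ^+ 2 - D * Q ^+ 2 = (-1) ^+ n * cq_s n.
Proof.
(* The norm of the next convergent involves the norms of the two preceding ones and their polar
   form, so all three enter the induction. *)
have key : let: (x, y) := cvg a n in
  [/\ y.1 ^+ 2 - D * y.2 ^+ 2 = (-1) ^+ n * cq_s n,
      x.1 ^+ 2 - D * x.2 ^+ 2 = - (-1) ^+ n * (rsu n).2 &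
      x.1 * y.1 - D * (x.2 * y.2) = - (-1) ^+ n * cq_r n].
  elim: n => [|n]; first by rewrite /cq_s /cq_r /=; split; ring.
  rewrite [cvg a n.+1]/=; case: (cvg a n) => [[p' q'] [p q]] /= [H1 H2 H3].
  rewrite cq_uS cq_sS cq_rS !(exprS (-1) n).
  set r := cq_r n in H3 *; set s := cq_s n in H1 *; set u := (rsu n).2 in H2 *.
  set e := (-1) ^+ n in H1 H2 H3 *; split.
  - transitivity (a n ^+ 2 * (p ^+ 2 - D * q ^+ 2)
      + 2%:R * a n * (p' * p - D * (q' * q)) + (p' ^+ 2 - D * q' ^+ 2)); first by ring.
    by rewrite H1 H2 H3; ring.
  - by rewrite H1; ring.
  - transitivity (a n * (p ^+ 2 - D * q ^+ 2) + (p' * p - D * (q' * q))); first by ring.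
    by rewrite H1 H3; ring.
by move: key; case: (cvg a n) => [[p' q'] [p q]] /= [].
Qed.

(** With the index shift of [cvg] this is [p_{n-1} - sqrt D q_{n-1}], which is [theta_{n-1}] up to a
    scalar. *)
Definition cq_err n : lser F := pser (cvg a n).2.1 - sD * pser (cvg a n).2.2.

Lemma cq_err_al n :
  cq_err n * al n = - (pser (cvg a n).1.1 - sD * pser (cvg a n).1.2).
Proof.
elim: n => [|n]; first by rewrite /cq_err /= !raddf0 !rmorph1 al_0; ring.
rewrite /cq_err [cvg a n.+1]/=; case: (cvg a n) => [[p' q'] [p q]] /=.
move=> IH.
have -> : pser (a n * p + p') - sD * pser (a n * q + q')
  = - (al n - pser (a n)) * (pser p - sD * pser q).
  have Ep : pser p' = sD * pser q' - (pser p - sD * pser q) * al n by rewrite IH; ring.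
  by rewrite !raddfD /= !pserM Ep; ring.
by rewrite -[in RHS](mul1r (_ - _)) -(al_step n); ring.
Qed.

Lemma cvg1S n : (cvg a n.+1).1 = (cvg a n).2.
Proof. by rewrite /=; case: (cvg a n). Qed.

Lemma cvg2S n : (cvg a n.+1).2 =
  (a n * (cvg a n).2.1 + (cvg a n).1.1, a n * (cvg a n).2.2 + (cvg a n).1.2).
Proof. by rewrite /=; case: (cvg a n). Qed.

Lemma size_a n : (2 <= size (a n.+1))%N.
Proof. by have [N N1 [_ ->]] := leads_al n. Qed.

Lemma size_Q n : (size (cvg a n).2.2 < size (cvg a n.+1).2.2)%N.
Proof.
elim: n => [|n IH]; first by rewrite /= mulr0 add0r size_poly1 size_poly0.
have a2 := size_a n.
have Q0 : (cvg a n.+1).2.2 != 0 by rewrite -size_poly_gt0; apply: leq_ltn_trans IH.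
have a0 : a n.+1 != 0 by rewrite -size_poly_gt0; apply: leq_trans a2.
have Q1 : (0 < size (cvg a n.+1).2.2)%N by rewrite size_poly_gt0.
have sz : size (a n.+1 * (cvg a n.+1).2.2) = (size (a n.+1) + size (cvg a n.+1).2.2).-1.
  exact: size_mul.
rewrite [in X in (_ < X)%N]cvg2S cvg1S [X in (_ < size X)%N]/= size_polyDl sz; lia.
Qed.

Lemma lead_Q n :
  lead_coef (cvg a n.+2).2.2 = lead_coef (a n.+1) * lead_coef (cvg a n.+1).2.2 /\
  size (cvg a n.+2).2.2 = ((size (a n.+1)).-1 + size (cvg a n.+1).2.2)%N.
Proof.
have a2 := size_a n; have sQ := size_Q n.
have Q0 : (cvg a n.+1).2.2 != 0 by rewrite -size_poly_gt0; apply: leq_ltn_trans sQ.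
have a0 : a n.+1 != 0 by rewrite -size_poly_gt0; apply: leq_trans a2.
have sz : size (a n.+1 * (cvg a n.+1).2.2) = (size (a n.+1) + size (cvg a n.+1).2.2).-1.
  exact: size_mul.
have lt : (size (cvg a n.+1).1.2 < size (a n.+1 * (cvg a n.+1).2.2)%R)%N.
  by rewrite sz cvg1S; lia.
rewrite cvg2S [(_, _).2]/= lead_coefDl // lead_coefM size_polyDl // sz.
by split=> //; lia.
Qed.

(** By [cq_err_al] the leading coefficient of the error is divided by that of [- a n.+1] at each
    step, while that of the denominator is multiplied by that of [a n.+1]; their product only
    changes sign. *)
Lemma leads_err n : exists c, [/\ leads (cq_err n) (- (size (cvg a n.+1).2.2).-1%:Z) c &
  c * lead_coef (cvg a n.+1).2.2 = 1 \/ c * lead_coef (cvg a n.+1).2.2 = -1].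
Proof.
elim: n => [|n [c [lx Hc]]].
  have -> : cq_err 0 = 1 by rewrite /cq_err pser1 raddf0 mulr0 subr0.
  have -> : (cvg a 1).2.2 = 1 by rewrite /= mulr0 add0r.
  exists 1; rewrite size_poly1 lead_coef1 mulr1.
  by split; [exact: leads_one|left].
have [N N1 [lal sza]] := leads_al n.
have E : cq_err n.+1 * al n.+1 = - cq_err n by rewrite cq_err_al cvg1S.
have [c0 xM bx] := lx.
have lN : leads (- cq_err n) (- (size (cvg a n.+1).2.2).-1%:Z) (- c).
  by split; [rewrite oppr_eq0|rewrite serN xM|exact: boundedN].
have e0 : cq_err n.+1 != 0.
  apply/eqP => E0; move: E; rewrite E0 mul0r => /esym/eqP; rewrite oppr_eq0 => /eqP Ex.
  by move: xM c0; rewrite Ex ser0 => <-; rewrite eqxx.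
have [M [c' le]] := neq0_leads e0; exists c'.
have := leadsM le lal; rewrite E => /(leads_inj lN)[EM Ec].
have [lQ sQ] := lead_Q n.
have s1 := size_Q n.
rewrite lQ sQ sza mulrA -Ec mulNr; split; last by case: Hc => ->; [right|left]; rewrite ?opprK.
by rewrite (_ : - _ = M) //; move: EM s1; lia.
Qed.

(** * The quartic case *)

Hypothesis size_D : size D = 5%N.

Let A := a 0%N.

Lemma sD_leads : [/\ leads sD 2 (lead_coef A), size A = 3%N & lead_coef A ^+ 2 = lead_coef D].
Proof.
have D0 : D != 0 by rewrite -size_poly_eq0 size_D.
have x0 : sD != 0.
  by apply/eqP => E; move/eqP: sD_sqr; rewrite E mul0r eq_sym pser_eq0 (negPf D0).
have [N [c lx]] := neq0_leads x0.
have := leadsM lx lx; rewrite sD_sqr => /(leads_inj (leads_pser D0)).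
rewrite size_D => -[EN Ec]; have {}EN : N = 2 by lia.
rewrite {}EN in lx; have [c0 xN bx] := lx.
have sz : size A = 3%N.
  apply/eqP; rewrite eqn_leq; apply/andP; split.
    by apply/leq_sizeP => j ltj; rewrite a_floor al_0 bx.
  by rewrite ltnNge; apply: contra c0 => /leq_sizeP/(_ 2%N (leqnn _));
    rewrite a_floor al_0 xN => ->.
by rewrite lead_coefE sz /= a_floor al_0 xN; split.
Qed.

Lemma size_A : size A = 3%N. Proof. by case: sD_leads. Qed.

Hypothesis two_neq0 : (2%:R : F) != 0.

(** A count of degrees. From [(sqrt D - r_{n+1}) al_{n+1} = s_n] and [deg s_n <= 1] the first factor
    has degree at most [0], and negative degree if [s_n] is constant; so [r_{n+1} - A] is constant,
    respectively zero. Then [s_{n+1} al_{n+1} = sqrt D + r_{n+1}] has degree exactly [2], as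
    [2 != 0], which bounds [deg s_{n+1}] by [1]. *)
Lemma size_s_r n : (size (cq_s n) <= 2)%N /\
  [/\ cq_r n.+1 = A + (cq_t n.+1)%:P & size (cq_s n) = 1%N -> cq_t n.+1 = 0].
Proof.
have [lsD szA lcA] := sD_leads.
have bsA : bounded_by (sD - pser A) (-1) by rewrite -al_0; exact: fracpart_bounded.
have key n' : (size (cq_s n') <= 2)%N ->
  [/\ cq_r n'.+1 = A + (cq_t n'.+1)%:P & size (cq_s n') = 1%N -> cq_t n'.+1 = 0].
  move=> sz; have [N N1 [lal _]] := leads_al n'.
  have x0 : sD - pser (cq_r n'.+1) != 0 by rewrite subr_eq0 sqrt_not_poly.
  have [M [c lx]] := neq0_leads x0.
  have := leadsM lx lal; rewrite cq_al_conj.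
  move=> /(leads_inj (leads_pser (cq_s_neq0 n')))[EM _].
  have [_ _ bx] := lx.
  have Hc (i : nat) : M < i%:Z -> (cq_r n'.+1 - A)`_i = 0.
    move=> ltM; have := bx _ ltM; have := bsA i%:Z isT.
    by rewrite !serB !pserE coefB => /eqP; rewrite subr_eq0 => /eqP-> /eqP;
      rewrite subr_eq0 => /eqP->; rewrite subrr.
  split; last by move=> s1; apply: Hc; move: EM; rewrite s1; lia.
  apply/eqP; rewrite addrC -subr_eq; apply/eqP/polyP => -[|i]; rewrite coefC //=.
  by apply: Hc; move: EM sz; lia.
elim: n => [|n [sz [Hr _]]]; first by split; [|apply: key]; rewrite /cq_s /= size_poly1.
suff sz' : (size (cq_s n.+1) <= 2)%N by split=> //; apply: key.
have [N N1 [lal _]] := leads_al n.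
have := leadsM (leads_pser (cq_s_neq0 n.+1)) lal; rewrite cq_al Hr.
have l2 : leads (sD + pser (A + (cq_t n.+1)%:P)) 2 (lead_coef A *+ 2).
  have [c0 sD2 bs] := lsD; split.
  - by rewrite -mulr_natl mulf_neq0.
  - by rewrite serD sD2 (pserE _ 2) coefD coefC addr0 lead_coefE szA mulr2n.
  - apply: boundedD => //; apply: (@pser_bounded _ _ 2).
    by rewrite (leq_trans (size_polyD _ _)) // szA geq_max /= (leq_trans (size_polyC_leq1 _)).
by move/(leads_inj l2) => [E _]; lia.
Qed.

Lemma size_s n : (size (cq_s n) <= 2)%N. Proof. by case: (size_s_r n). Qed.

Lemma cq_rE n : cq_r n.+1 = A + (cq_t n.+1)%:P.
Proof. by case: (size_s_r n) => _ []. Qed.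

Lemma cq_t_const n : size (cq_s n) = 1%N -> cq_t n.+1 = 0.
Proof. by case: (size_s_r n) => _ []. Qed.

Lemma cq_a_s n : a n.+1 * cq_s n.+1 = A *+ 2 + (cq_t n.+1 + cq_t n.+2)%:P.
Proof.
have := cq_rS n.+1; rewrite !cq_rE polyCD => /eqP.
by rewrite eq_sym subr_eq => /eqP->; ring.
Qed.

Lemma cq_s_s n : cq_s n * cq_s n.+1 = D - (A + (cq_t n.+1)%:P) ^+ 2.
Proof. by rewrite cq_norm cq_rE. Qed.

End CompleteQuotients.

(** * Periodicity *)

(* The polynomial shadow of the expansion of [sqrt D], where
   [al n = (A + t n + sqrt D) / s n] for [n >= 1]; [t 0] is junk. *)
Record quad_cf (F : fieldType) (A D : {poly F}) (a s : nat -> {poly F})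
    (t : nat -> F) : Prop := {
  qcf_size_A : size A = 3%N;
  qcf_s0 : s 0%N = 1;
  qcf_s_neq0 : forall n, s n != 0;
  qcf_size_s : forall n, (size (s n) <= 2)%N;
  qcf_a_s : forall n, a n.+1 * s n.+1 = A *+ 2 + (t n.+1 + t n.+2)%:P;
  qcf_s_s : forall n, s n * s n.+1 = D - (A + (t n.+1)%:P) ^+ 2;
  qcf_t_const : forall n, size (s n) = 1%N -> t n.+1 = 0 }.

Section QuadCF.
Variables (F : fieldType) (A D : {poly F}) (a s : nat -> {poly F}) (t : nat -> F).
Hypothesis two_neq0 : (2%:R : F) != 0.
Hypothesis H : quad_cf A D a s t.

Lemma qcf_t1 : t 1%N = 0.
Proof. by apply: (qcf_t_const H); rewrite (qcf_s0 H) size_poly1. Qed.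

Lemma qcf_s1 : s 1%N = D - A ^+ 2.
Proof. by have := qcf_s_s H 0; rewrite (qcf_s0 H) mul1r qcf_t1 addr0. Qed.

Lemma qcf_A2_neq0 : A`_2 != 0.
Proof.
have -> : A`_2 = lead_coef A by rewrite lead_coefE (qcf_size_A H).
by rewrite lead_coef_eq0 -size_poly_eq0 (qcf_size_A H).
Qed.

(** The product is [s 1 - 2 t A - t ^ 2] with [s 1 = D - A ^ 2] of degree at most [1], so its [X^2]
    coefficient determines [t]. *)
Lemma qcf_s_s_coef2 n : (s n * s n.+1)`_2 = - (2%:R * t n.+1 * A`_2).
Proof.
have -> : s n * s n.+1 = s 1%N - (2%:R * t n.+1)%:P * A - (t n.+1 ^+ 2)%:P.
  by rewrite (qcf_s_s H) qcf_s1; ring.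
rewrite !coefB coefCM coefC subr0 nth_default ?sub0r //.
exact: (qcf_size_s H).
Qed.

Lemma size_twoA c : size (A *+ 2 + c%:P) = 3%N.
Proof.
have sz : size (A *+ 2) = 3%N.
  by rewrite -scaler_nat size_scale // (qcf_size_A H).
by rewrite size_polyDl sz // (leq_ltn_trans (size_polyC_leq1 _)).
Qed.

Lemma qcf_size_a n : (size (a n.+1) + size (s n.+1) = 4)%N.
Proof.
have Es := qcf_a_s H n.
have := congr1 (fun p : {poly F} => size p) Es; rewrite /= size_twoA => E3.
have a0 : a n.+1 != 0.
  by apply/eqP => E; move: E3; rewrite E mul0r size_poly0.
have a1 : (0 < size (a n.+1))%N by rewrite size_poly_gt0.
have sz : size (a n.+1 * s n.+1) = (size (a n.+1) + size (s n.+1)).-1.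
  exact: size_mul (qcf_s_neq0 H _).
move: E3 a1; rewrite sz; move: (size (a n.+1)) (size (s n.+1)); lia.
Qed.

Lemma qcf_size_s_cases n : size (s n) = 1%N \/ size (s n) = 2%N.
Proof.
by have := qcf_size_s H n; have := qcf_s_neq0 H n; rewrite -size_poly_gt0;
  case: (size _) => [|[|[|]]] // _ _; [left|right].
Qed.

(** The product [s n * s n.+1] then has degree at most [1], so its [X^2] coefficient vanishes. The
    field [qcf_t_const] gives the same for the index after a constant [s]. *)
Lemma const_t0 n : size (s n.+1) = 1%N -> t n.+1 = 0.
Proof.
move=> s1; have := qcf_s_s_coef2 n; rewrite nth_default; last first.
  rewrite size_mul ?(qcf_s_neq0 H) // s1 addn1 /=; exact: (qcf_size_s H).
move/eqP; rewrite eq_sym oppr_eq0 !mulf_eq0 (negPf two_neq0) (negPf qcf_A2_neq0).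
by rewrite orbF => /eqP.
Qed.

Lemma linear_root (p : {poly F}) : size p = 2%N -> exists z, root p z.
Proof.
move=> s2; exists (- p`_0 / p`_1); rewrite rootE horner_coef s2 !big_ord_recl big_ord0 /=.
have p1 : p`_1 != 0.
  have -> : p`_1 = lead_coef p by rewrite lead_coefE s2.
  by rewrite lead_coef_eq0 -size_poly_eq0 s2.
by apply/eqP; rewrite /bump /=; field.
Qed.

Lemma qcf_t_root n z : root (s n.+1) z -> 2%:R * A.[z] + t n.+1 + t n.+2 = 0.
Proof.
move=> rz; have := congr1 (fun p => p.[z]) (qcf_a_s H n).
rewrite hornerM (rootP rz) mulr0 hornerD hornerMn hornerC => E.
by rewrite -addrA mulr_natl -E.
Qed.

Lemma scale_cancel (p q p' q' : {poly F}) c : c != 0 -> p != 0 ->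
  p * q = p' * q' -> p' = c *: p -> q' = c^-1 *: q.
Proof.
move=> c0 p0 E Ep; apply: (mulfI p0).
by rewrite -scalerAr E Ep -scalerAl scalerA mulVf // scale1r.
Qed.

(** [c] to the power [(-1) ^ i], the alternating factor in the notion of quasi-period. *)
Definition alt (c : F) (i : nat) := if odd i then c^-1 else c.

Lemma altS c i : alt c i.+1 = (alt c i)^-1.
Proof. by rewrite /alt /=; case: odd => //=; rewrite invrK. Qed.

Lemma alt_neq0 c i : c != 0 -> alt c i != 0.
Proof. by rewrite /alt; case: odd; rewrite ?invr_eq0. Qed.

Lemma size_alt c i (p : {poly F}) : c != 0 -> size (alt c i *: p) = size p.
Proof. by move=> c0; rewrite size_scale // alt_neq0. Qed.

Lemma qcf_next n m c : c != 0 -> s m = c *: s n -> t m.+1 = t n.+1 ->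
  s m.+1 = c^-1 *: s n.+1.
Proof.
move=> c0 Es Et; apply: (scale_cancel c0 (qcf_s_neq0 H n)) Es.
by rewrite !(qcf_s_s H) Et.
Qed.

Lemma qcf_t_next n m c : c != 0 -> s m.+1 = c *: s n.+1 -> t m.+1 = t n.+1 ->
  t m.+2 = t n.+2.
Proof.
move=> c0 Es Et; have [s1|s2] := qcf_size_s_cases n.+1.
  by rewrite !(qcf_t_const H) // Es size_scale.
have [z rz] := linear_root s2.
have rz' : root (s m.+1) z by rewrite Es rootZ.
have := qcf_t_root rz; rewrite -(qcf_t_root rz') Et.
by move/addrI.
Qed.

(** The pair of [s n], up to scaling, and [t n.+1] determines the sequel: the product formula gives
    the next [s] and inverts the scalar; the root of that [s], which ignores the scalar, gives the
    next [t]. *)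
Lemma qcf_forward n m c i : c != 0 -> s m = c *: s n -> t m.+1 = t n.+1 ->
  s (m + i)%N = alt c i *: s (n + i)%N /\ t (m + i).+1 = t (n + i).+1.
Proof.
move=> c0 Es Et; elim: i => [|i [IHs IHt]]; first by rewrite !addn0.
rewrite !addnS altS; have Es' := qcf_next (alt_neq0 i c0) IHs IHt.
by split=> //; apply: qcf_t_next Es' IHt; rewrite invr_eq0 alt_neq0.
Qed.

Lemma qcf_forward_a n m c i : c != 0 -> s m = c *: s n -> t m.+1 = t n.+1 ->
  a (m + i).+1 = alt c i *: a (n + i).+1.
Proof.
move=> c0 Es Et; have [Hs Ht] := qcf_forward i c0 Es Et.
have [Hs' Ht'] := qcf_forward i.+1 c0 Es Et; move: Hs' Ht'; rewrite !addnS altS => Hs' Ht'.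
rewrite -[alt c i]invrK; apply: (scale_cancel _ (qcf_s_neq0 H (n + i).+1)) Hs'.
  by rewrite invr_eq0 alt_neq0.
by rewrite mulrC [RHS]mulrC !(qcf_a_s H) Ht Ht'.
Qed.

(** * Constant denominators and quasi-periods *)

Lemma size1_scale1 n : size (s n) = 1%N -> s n = (s n)`_0 *: s 0%N /\ (s n)`_0 != 0.
Proof.
move=> s1; have E : s n = ((s n)`_0)%:P by apply: size1_polyC; rewrite s1.
split; first by rewrite (qcf_s0 H) alg_polyC.
by have := qcf_s_neq0 H n; rewrite E polyC_eq0 coefC.
Qed.

Lemma const_repeat N : size (s N) = 1%N ->
  forall i, a (N + i).+1 = alt (s N)`_0 i *: a i.+1.
Proof.
move=> s1 i; have [E c0] := size1_scale1 s1.
by have := @qcf_forward_a 0%N N _ i c0 E; apply; rewrite qcf_t1 (qcf_t_const H).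
Qed.

Lemma const_repeat_size N i : size (s N) = 1%N -> size (s (N + i)%N) = size (s i).
Proof.
move=> s1; have [E c0] := size1_scale1 s1.
have [] := @qcf_forward 0%N N _ i c0 E; first by rewrite qcf_t1 (qcf_t_const H).
by move=> -> _; rewrite size_alt.
Qed.

Lemma const_quasi_period N : size (s N) = 1%N -> quasi_period a N.
Proof.
move=> s1; have [E c0] := size1_scale1 s1.
exists 1%N, (s N)`_0; split=> // -[//|n] _.
rewrite addnC addnS (const_repeat s1) scalerA /alt /=.
by case: (odd n); rewrite /= ?mulfV ?mulVf ?scale1r.
Qed.

(** The relations for [s n * s n.+1] and for [t n.+1 + t n.+2] are symmetric, so the expansion can
    be read backwards from the constant [s N] as it is read forwards from [s 0]. Minimality of [N]
    makes every [s] in between linear, hence with a root. *)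
Lemma qcf_palindrome N : (0 < N)%N -> size (s N) = 1%N ->
  (forall i, (0 < i < N)%N -> size (s i) = 2%N) ->
  forall i, (i <= N)%N -> s (N - i)%N = alt (s N)`_0 i *: s i /\
                          ((i < N)%N -> t (N - i)%N = t i.+1).
Proof.
move=> N0 s1 s2; have [E c0] := size1_scale1 s1.
elim=> [|i IH] leN.
  rewrite subn0 /alt /=; split=> // _; rewrite qcf_t1.
  by case: N N0 s1 {s2 E c0 leN} => // N _; apply: const_t0.
have [IHs /(_ leN) IHt] := IH (ltnW leN).
have EN : (N - i = (N - i.+1).+1)%N by lia.
have Es : s (N - i.+1)%N = alt (s N)`_0 i.+1 *: s i.+1.
  rewrite altS; apply: (scale_cancel _ (qcf_s_neq0 H i)) IHs; first exact: alt_neq0.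
  by rewrite [RHS]mulrC EN !(qcf_s_s H) -EN IHt.
split=> // ltN; have [z rz] := linear_root (s2 _ (ltN : (0 < i.+1 < N)%N)).
have rz' : root (s (N - i.+1)%N) z by rewrite Es rootZ ?alt_neq0.
have EN' : (N - i.+1 = (N - i.+2).+1)%N by lia.
rewrite EN' in rz' *; have := qcf_t_root rz'; rewrite -(qcf_t_root rz).
rewrite -EN' -EN IHt -!addrA => /addrI; rewrite [RHS]addrC.
by move/addIr.
Qed.

Lemma first_const n : (0 < n)%N -> size (s n) = 1%N ->
  exists N, [/\ (0 < N)%N, size (s N) = 1%N &
                forall i, (0 < i < N)%N -> size (s i) = 2%N].
Proof.
move=> n0 s1; have ex : exists N, (0 < N)%N && (size (s N) == 1%N).
  by exists n; rewrite n0 s1 eqxx.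
case: (ex_minnP ex) => N /andP[N0 /eqP sN] minN; exists N; split=> // i /andP[i0 iN].
have [si|//] := qcf_size_s_cases i.
by have := minN i; rewrite i0 si eqxx => /(_ isT); lia.
Qed.

Lemma const_periodic n : (0 < n)%N -> size (s n) = 1%N -> cf_periodic a.
Proof.
move=> n0 s1; have [N [N0 sN s2]] := first_const n0 s1.
have [E c0] := size1_scale1 sN.
(* For odd [N] the scalar is inverted from one quasi-period to the next, so that [2 N] is a
   period. *)
case oddN : (odd N).
  exists 1%N, (N + N)%N; split=> [|[//|i] _]; first by lia.
  rewrite addSn addnC -addnA (const_repeat sN) (const_repeat sN) scalerA /alt oddD oddN /=.
  by case: (odd i); rewrite /= ?mulfV ?mulVf ?scale1r.
(* For even [N] the palindrome fixes the index [N / 2], where the nonzero [s] is a multiple of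
   itself; this forces the scalar to be [1]. *)
have c1 : (s N)`_0 = 1.
  have lt : (N./2 <= N)%N by lia.
  have [+ _] := qcf_palindrome N0 sN s2 lt.
  rewrite (_ : N - N./2 = N./2)%N; last by have := odd_double_half N; rewrite oddN; lia.
  move/eqP; rewrite -{1}[s N./2]scale1r -subr_eq0 -scalerBl scaler_eq0.
  rewrite (negPf (qcf_s_neq0 H _)) orbF subr_eq0 /alt eq_sym; case: odd => /eqP // E1.
  by rewrite -[LHS]invrK E1 invr1.
exists 1%N, N; split=> // -[//|i] _.
by rewrite addSn addnC (const_repeat sN) /alt c1 invr1 if_same scale1r.
Qed.

(** If all [s n] with [n >= 1] were linear, the quasi-period could be carried back to index [0], and
    [s l] would be a multiple of [s 0 = 1]. *)
Lemma linear_not_quasi_periodic l : (0 < l)%N -> quasi_period a l ->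
  exists2 n, (0 < n)%N & size (s n) = 1%N.
Proof.
move=> l0 [m [mu [mu0 Hq]]]; apply: contrapT => noconst.
have s2 n : size (s n.+1) = 2%N.
  have [s1|//] := qcf_size_s_cases n.+1.
  by case: noconst; exists n.+1.
have a2 n : size (a n.+1) = 2%N by have := qcf_size_a n; rewrite s2; lia.
(* Times [a (n.+1 + l)], the difference of the two sides is a constant, because [2 A] cancels; [a]
   being linear, the difference is zero. *)
have Hs n : (m <= n.+1)%N -> s (n.+1 + l)%N = alt mu n.+1 *: s n.+1.
  move=> le_m; have Ea := Hq _ le_m; rewrite -/(alt mu n.+1) in Ea.
  apply/eqP; rewrite -subr_eq0; apply: contraTT isT => d0.
  set d := s _ - _ in d0.
  have szd : (size (a (n.+1 + l)%N * d)%R <= 1)%N.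
    rewrite /d mulrBr -scalerAr scalerAl -Ea !(qcf_a_s H).
    by rewrite opprD addrACA subrr add0r -polyCB size_polyC_leq1.
  have a0 : a (n.+1 + l)%N != 0 by rewrite -size_poly_eq0 addSn a2.
  have sza : size (a (n.+1 + l)%N) = 2%N := a2 _.
  have sz : size (a (n.+1 + l)%N * d) = (size d).+1 by rewrite size_mul ?sza.
  by move: szd d0; rewrite sz -size_poly_gt0; case: (size d).
have Ht n : (m <= n.+1)%N -> t (n.+1 + l).+1 = t n.+2.
  move=> le_m; have := qcf_s_s_coef2 (n.+1 + l); rewrite Hs // -addSn Hs 1?leqW //.
  rewrite -scalerAl -scalerAr scalerA (altS mu n.+1) mulfV ?alt_neq0 // scale1r.
  rewrite qcf_s_s_coef2 => /oppr_inj /(mulIf qcf_A2_neq0) /(mulfI two_neq0) E.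
  by rewrite E addSn.
(* Descent from [m.+1]: the root of the later [s] returns the earlier [t], and the product formula
   then returns the earlier [s]. *)
have back n : exists2 c, c != 0 & s (n + l)%N = c *: s n /\ t (n + l).+1 = t n.+1.
  case: (leqP m.+1 n) => [|lt_n].
    case: n => // n le_m; exists (alt mu n.+1); first exact: alt_neq0.
    by rewrite Hs 1?ltnW // Ht // ltnW.
  have -> : n = (m.+1 - (m.+1 - n))%N by lia.
  elim: (m.+1 - n)%N => [|i [c c0 [IHs IHt]]].
    rewrite subn0; exists (alt mu m.+1); first exact: alt_neq0.
    by rewrite Hs // Ht.
  case: (leqP m.+1 i) => [le_i|lt_i].
    by exists c => //; rewrite (_ : m.+1 - i.+1 = m.+1 - i)%N //; lia.
  have En : (m.+1 - i = (m.+1 - i.+1).+1)%N by lia.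
  move: IHs IHt; rewrite En; set j := (m.+1 - i.+1)%N => IHs IHt.
  have [z rz] := linear_root (s2 j).
  have rz' : root (s (j + l).+1) z by rewrite -addSn IHs rootZ.
  have Et : t (j + l).+1 = t j.+1.
    have := qcf_t_root rz; rewrite -(qcf_t_root rz') -addSn IHt.
    by move/addIr/addrI.
  exists c^-1; first by rewrite invr_eq0.
  split=> //; apply: (scale_cancel c0 (qcf_s_neq0 H j.+1)) IHs.
  by rewrite mulrC [RHS]mulrC addSn !(qcf_s_s H) Et.
have [c c0 [Es _]] := back 0%N.
move: Es; rewrite add0n (qcf_s0 H) => Es; apply: noconst; exists l => //.
by rewrite Es size_scale // size_poly1.
Qed.

Lemma qperiod_first_const l : qperiod_length a l ->
  [/\ (0 < l)%N, size (s l) = 1%N & forall i, (0 < i < l)%N -> size (s i) = 2%N].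
Proof.
move=> [l0 [Hq minl]]; have [n n0 sn] := linear_not_quasi_periodic l0 Hq.
have [N [N0 sN s2]] := first_const n0 sn.
have leN : (l <= N)%N by apply: minl => //; apply: const_quasi_period.
suff sl : size (s l) = 1%N by split=> // i /andP[i0 il]; apply: s2; rewrite i0 (leq_trans il).
have [m [mu [mu0 Ha]]] := Hq.
have sM k i : size (s (k * N + i)%N) = size (s i).
  by elim: k => [//|k IH]; rewrite mulSn -addnA const_repeat_size.
(* At a multiple of [N] beyond [m] the denominator is constant, so [a n'] is quadratic. By
   quasi-periodicity so is [a (n' + l)]; hence [s (n' + l)] is constant, and it has the size of
   [s l]. *)
pose n' := (m.+1 * N)%N; have n'0 : (0 < n')%N by rewrite muln_gt0.
have ltm : (m <= n')%N by rewrite /n'; nia.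
have := Ha _ ltm; rewrite -/(alt mu n') => Ea.
have s1 : size (s n') = 1%N by rewrite -[n']addn0 sM (qcf_s0 H) size_poly1.
have : size (a n') = size (a (n' + l)%N) by rewrite Ea size_alt.
move: n'0 s1 (sM m.+1 l); rewrite -/n'; case: n' {ltm Ea} => // j _ s1 sl.
rewrite addSn in sl *.
by have := qcf_size_a j; have := qcf_size_a (j + l); rewrite s1 -sl; lia.
Qed.

End QuadCF.

(** * Gauss valuation and reduction *)

Section Valuation.
Variables (K k : fieldType) (v : K -> int) (pi : K) (red : K -> k).
Hypothesis HK : dvr v pi.
Hypothesis Hred : residue v red.

(* [m <= v x] with the convention [v 0 = +oo]; [inO v] is the case [m = 0]. *)
Definition vge (x : K) (m : int) : bool := (x == 0) || (m <= v x).

Lemma v1 : v 1 = 0.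
Proof.
have := dvr_mul HK (oner_neq0 K) (oner_neq0 K); rewrite mulr1 => /eqP.
by rewrite -subr_eq0 opprD addNKr oppr_eq0 => /eqP.
Qed.

Lemma vM (x y : K) : x != 0 -> y != 0 -> v (x * y) = v x + v y.
Proof. exact: (dvr_mul HK). Qed.

Lemma vN (x : K) : v (- x) = v x.
Proof.
have [->|x0] := eqVneq x 0; first by rewrite oppr0.
have n1 : (-1 : K) != 0 by rewrite oppr_eq0 oner_eq0.
have := vM n1 n1; rewrite mulrNN mulr1 v1 => E.
by rewrite -mulN1r vM //; lia.
Qed.

Lemma vV (x : K) : x != 0 -> v x^-1 = - v x.
Proof.
move=> x0; have x1 : x^-1 != 0 by rewrite invr_eq0.
by have := vM x0 x1; rewrite mulfV // v1; lia.
Qed.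

Lemma vXn (x : K) n : x != 0 -> v (x ^+ n) = v x *+ n.
Proof.
move=> x0; elim: n => [|n IH]; first by rewrite expr0 v1.
by rewrite exprS vM ?expf_neq0 // IH mulrS.
Qed.

Lemma vpi (m : int) : v (pi ^ m) = m.
Proof.
have p0 := dvr_pi_neq0 HK.
case: m => n; first by rewrite -exprnP vXn // (dvr_pi HK) -mulr_natr mul1r natz.
rewrite NegzE -exprnN vV ?expf_neq0 // vXn // (dvr_pi HK) -mulr_natr mul1r natz //.
Qed.

Lemma pi_neq0 (m : int) : pi ^ m != 0.
Proof. by rewrite expfz_neq0 // (dvr_pi_neq0 HK). Qed.

Lemma vge0 m : vge 0 m. Proof. by rewrite /vge eqxx. Qed.

Lemma vgeE (x : K) m : x != 0 -> vge x m = (m <= v x).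
Proof. by rewrite /vge => /negPf->. Qed.

Lemma vge_refl (x : K) : vge x (v x). Proof. by rewrite /vge lexx orbT. Qed.

Lemma vgeW (x : K) m n : n <= m -> vge x m -> vge x n.
Proof. by rewrite /vge => nm /orP[->//|/(le_trans nm)->]; rewrite orbT. Qed.

Lemma vgeD (x y : K) m : vge x m -> vge y m -> vge (x + y) m.
Proof.
have [->|x0] := eqVneq x 0; first by rewrite add0r.
have [->|y0] := eqVneq y 0; first by rewrite addr0.
have [->|xy0] := eqVneq (x + y) 0; first by rewrite vge0.
rewrite !vgeE // => mx my; apply: le_trans (dvr_add HK x0 y0 xy0).
by rewrite le_min mx.
Qed.

Lemma vgeN (x : K) m : vge (- x) m = vge x m.
Proof. by rewrite /vge oppr_eq0 vN. Qed.

Lemma vgeB (x y : K) m : vge x m -> vge y m -> vge (x - y) m.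
Proof. by move=> Hx Hy; apply: vgeD => //; rewrite vgeN. Qed.

Lemma vgeM (x y : K) m n : vge x m -> vge y n -> vge (x * y) (m + n).
Proof.
have [->|x0] := eqVneq x 0; first by move=> _ _; rewrite mul0r vge0.
have [->|y0] := eqVneq y 0; first by move=> _ _; rewrite mulr0 vge0.
by rewrite !vgeE ?mulf_neq0 // vM // => *; apply: lerD.
Qed.

Lemma vge_sum (I : Type) (r : seq I) (P : pred I) (f : I -> K) m :
  (forall i, P i -> vge (f i) m) -> vge (\sum_(i <- r | P i) f i) m.
Proof.
move=> Hf; apply: (big_ind (fun x => vge x m)) => //; first exact: vge0.
by move=> *; apply: vgeD.
Qed.

Lemma vD_lt (x y : K) : x != 0 -> vge y (v x + 1) -> x + y != 0 /\ v (x + y) = v x.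
Proof.
move=> x0 Hy.
have Hx : ~~ vge x (v x + 1) by rewrite vgeE //; lia.
have xy0 : x + y != 0.
  by apply: contra Hx; rewrite addrC addr_eq0 => /eqP Ey; move: Hy; rewrite Ey vgeN.
split=> //; apply/eqP; rewrite eq_le; apply/andP; split; last first.
  by rewrite -vgeE //; apply: vgeD (vge_refl x) _; apply: vgeW Hy; lia.
rewrite leNgt; apply: contra Hx => lt; rewrite -[X in vge X](addrK y x); apply: vgeB => //.
by rewrite vgeE // lezD1.
Qed.

Lemma inO_vge (x : K) : inO v x = vge x 0. Proof. by []. Qed.

Lemma inO0 : inO v 0. Proof. exact: vge0. Qed.
Lemma inO1 : inO v 1. Proof. by rewrite inO_vge /vge v1 lexx orbT. Qed.
Lemma inOD (x y : K) : inO v x -> inO v y -> inO v (x + y). Proof. exact: vgeD. Qed.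
Lemma inON (x : K) : inO v x -> inO v (- x). Proof. by rewrite !inO_vge vgeN. Qed.
Lemma inOB (x y : K) : inO v x -> inO v y -> inO v (x - y). Proof. exact: vgeB. Qed.
Lemma inOM (x y : K) : inO v x -> inO v y -> inO v (x * y).
Proof. by move=> Hx Hy; have := vgeM Hx Hy; rewrite addr0. Qed.
Lemma inO_v0 (x : K) : v x = 0 -> inO v x.
Proof. by move=> E; rewrite /inO E lexx orbT. Qed.

Lemma red0 : red 0 = 0.
Proof. by apply/eqP; rewrite (red_ker Hred) ?inO0 // eqxx. Qed.

Lemma redD (x y : K) : inO v x -> inO v y -> red (x + y) = red x + red y.
Proof. exact: (red_add Hred). Qed.

Lemma redM (x y : K) : inO v x -> inO v y -> red (x * y) = red x * red y.
Proof. exact: (red_mul Hred). Qed.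

Lemma redN (x : K) : inO v x -> red (- x) = - red x.
Proof.
move=> Hx; apply/eqP; rewrite -addr_eq0 -redD ?inON //.
by rewrite addNr red0.
Qed.

Lemma red_sum (I : Type) (r : seq I) (P : pred I) (f : I -> K) :
  (forall i, inO v (f i)) -> red (\sum_(i <- r | P i) f i) = \sum_(i <- r | P i) red (f i).
Proof.
move=> Hf; suff [] : inO v (\sum_(i <- r | P i) f i) /\
  red (\sum_(i <- r | P i) f i) = \sum_(i <- r | P i) red (f i) by [].
apply: (big_ind2 (fun x y => inO v x /\ red x = y)) => //.
- by split; [exact: inO0|exact: red0].
- by move=> x1 x2 y1 y2 [? <-] [? <-]; split; [exact: inOD|exact: redD].
Qed.

Lemma red_neq0 (x : K) : inO v x -> red x != 0 -> x != 0 /\ v x = 0.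
Proof.
move=> Hx; rewrite (red_ker Hred) // negb_or => /andP[x0 vx]; split=> //.
by move: Hx; rewrite inO_vge vgeE //; lia.
Qed.

Lemma unit_red (x : K) : x != 0 -> v x = 0 -> red x != 0.
Proof. by move=> x0 vx; rewrite (red_ker Hred) ?inO_v0 // (negPf x0) vx. Qed.

Lemma red_pos (x : K) : inO v x -> (red x == 0) = vge x 1.
Proof. by move=> Hx; rewrite (red_ker Hred). Qed.

(** * Integral polynomials and their reduction *)

Definition OP (p : {poly K}) := forall i, inO v p`_i.
Definition rp (p : {poly K}) : {poly k} := map_poly red p.

Lemma coef_rp (p : {poly K}) i : (rp p)`_i = red p`_i.
Proof. by rewrite coef_map_id0 // red0. Qed.

Lemma OPD (p q : {poly K}) : OP p -> OP q -> OP (p + q).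
Proof. by move=> Hp Hq i; rewrite coefD; apply: inOD. Qed.
Lemma OPN (p : {poly K}) : OP p -> OP (- p).
Proof. by move=> Hp i; rewrite coefN; apply: inON. Qed.
Lemma OPB (p q : {poly K}) : OP p -> OP q -> OP (p - q).
Proof. by move=> Hp Hq; apply: OPD => //; apply: OPN. Qed.
Lemma OPM (p q : {poly K}) : OP p -> OP q -> OP (p * q).
Proof. by move=> Hp Hq i; rewrite coefM; apply: vge_sum => j _; apply: inOM. Qed.
Lemma OPC (c : K) : inO v c -> OP c%:P.
Proof. by move=> Hc i; rewrite coefC; case: eqP; rewrite ?inO0. Qed.
Lemma OPZ (c : K) (p : {poly K}) : inO v c -> OP p -> OP (c *: p).
Proof. by move=> Hc Hp i; rewrite coefZ; apply: inOM. Qed.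

Lemma rpD (p q : {poly K}) : OP p -> OP q -> rp (p + q) = rp p + rp q.
Proof. by move=> Hp Hq; apply/polyP => i; rewrite coefD !coef_rp coefD redD. Qed.
Lemma rpN (p : {poly K}) : OP p -> rp (- p) = - rp p.
Proof. by move=> Hp; apply/polyP => i; rewrite coefN !coef_rp coefN redN. Qed.
Lemma rpB (p q : {poly K}) : OP p -> OP q -> rp (p - q) = rp p - rp q.
Proof. by move=> Hp Hq; rewrite rpD ?rpN //; apply: OPN. Qed.
Lemma rpM (p q : {poly K}) : OP p -> OP q -> rp (p * q) = rp p * rp q.
Proof.
move=> Hp Hq; apply/polyP => i; rewrite coef_rp !coefM red_sum => [|j].
  by apply: eq_bigr => j _; rewrite redM // !coef_rp.
exact: inOM.
Qed.
Lemma rpC (c : K) : rp c%:P = (red c)%:P.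
Proof. by apply/polyP => i; rewrite coef_rp !coefC; case: eqP; rewrite ?red0. Qed.
Lemma rpZ (c : K) (p : {poly K}) : inO v c -> OP p -> rp (c *: p) = red c *: rp p.
Proof. by move=> Hc Hp; apply/polyP => i; rewrite coefZ !coef_rp coefZ redM. Qed.

Lemma size_rp (p : {poly K}) : (size (rp p) <= size p)%N.
Proof. by apply/leq_sizeP => j ltj; rewrite coef_rp nth_default // red0. Qed.

Lemma OP_horner (p : {poly K}) (z : K) :
  OP p -> inO v z -> inO v p.[z] /\ red p.[z] = (rp p).[red z].
Proof.
elim/poly_ind: p => [|p c IH] Hp Hz.
  by rewrite /rp map_poly0 !horner0 red0 inO0.
have Hc : inO v c.
  by have := Hp 0%N; rewrite coefD coefMX coefC /= add0r.
have Op : OP p.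
  by move=> i; have := Hp i.+1; rewrite coefD coefMX coefC /= addr0.
have [Hpz Epz] := IH Op Hz; have Opz : inO v (p.[z] * z) by exact: inOM.
have OX : OP 'X by move=> i; rewrite coefX; case: eqP; rewrite ?inO0 ?inO1.
have rX : rp 'X = 'X.
  by apply/polyP => i; rewrite coef_rp !coefX; case: eqP; rewrite ?red0 ?(red_1 Hred).
rewrite rpD ?rpM ?rX ?rpC //; [|exact: OPM|exact: OPC].
rewrite !hornerMXaddC; split; first exact: inOD.
by rewrite redD // redM // Epz.
Qed.

(** * The Gauss valuation *)

Lemma nuP_le (p : {poly K}) i : p`_i != 0 -> nuP v p <= v p`_i.
Proof.
move=> pi0; have lti : (i < size p)%N.
  by rewrite ltnNge; apply: contra pi0 => le; rewrite nth_default.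
exact: (@bigmin_le_cond _ _ _ _ (Ordinal lti) (fun i => p`_i != 0)).
Qed.

Lemma nuP_ge (p : {poly K}) m : p != 0 -> (forall i, vge p`_i m) -> m <= nuP v p.
Proof.
move=> p0 Hm; apply: le_bigmin => [|i pi0]; last by rewrite -vgeE.
by rewrite -vgeE ?lead_coef_eq0 //; apply: Hm.
Qed.

Lemma nuP_vge (p : {poly K}) i : vge p`_i (nuP v p).
Proof. by rewrite /vge; case: eqP => //= /eqP/nuP_le. Qed.

Lemma nuP_attained (p : {poly K}) : p != 0 -> exists i, p`_i != 0 /\ v p`_i = nuP v p.
Proof.
move=> p0; apply: contrapT => no.
suff : nuP v p + 1 <= nuP v p by lia.
apply: nuP_ge => // i; rewrite /vge; case: eqP => //= /eqP pi0.
have := nuP_le pi0; rewrite le_eqVlt => /orP[/eqP E|]; last by rewrite lezD1.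
by case: no; exists i.
Qed.

(** The primitive polynomials of Gauss's lemma, those of Gauss valuation [0]. *)
Definition prim (p : {poly K}) := OP p /\ rp p != 0.

Lemma OP_nuP (p : {poly K}) : p != 0 -> OP p <-> 0 <= nuP v p.
Proof.
move=> p0; split=> [Hp|Hp i]; first by apply: nuP_ge => // i; apply: Hp.
by apply: vgeW (nuP_vge p i).
Qed.

Lemma nuPZ (c : K) (p : {poly K}) : c != 0 -> p != 0 -> nuP v (c *: p) = v c + nuP v p.
Proof.
move=> c0 p0; have cp0 : c *: p != 0 by rewrite scaler_eq0 negb_or c0.
apply/eqP; rewrite eq_le; apply/andP; split.
  have [i [pi0 <-]] := nuP_attained p0; rewrite -vM // -coefZ.
  by apply: nuP_le; rewrite coefZ mulf_neq0.
by apply: nuP_ge => // i; rewrite coefZ; apply: vgeM (vge_refl _) (nuP_vge _ _).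
Qed.

Lemma prim_neq0 (p : {poly K}) : prim p -> p != 0.
Proof. by move=> [_]; apply: contra => /eqP->; rewrite /rp map_poly0. Qed.

Lemma nuP_prim (p : {poly K}) : prim p -> nuP v p = 0.
Proof.
move=> Hp; have p0 := prim_neq0 Hp; have [Op rp0] := Hp.
apply/eqP; rewrite eq_le (OP_nuP p0).1 // andbT leNgt; apply: contra rp0 => lt.
apply/eqP/polyP => i; rewrite coef_rp coef0; apply/eqP.
by rewrite red_pos //; apply: vgeW (nuP_vge p i); lia.
Qed.

Lemma prim_nuP (p : {poly K}) : p != 0 -> nuP v p = 0 -> prim p.
Proof.
move=> p0 n0; have Op : OP p by apply/OP_nuP => //; rewrite n0.
split=> //; have [i [pi0 vi]] := nuP_attained p0.
apply/eqP => E; have := unit_red pi0; rewrite vi n0 -coef_rp E coef0 eqxx.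
by move/(_ erefl).
Qed.

Lemma nuP_scale_prim (p : {poly K}) (c : K) (q : {poly K}) :
  c != 0 -> prim q -> p = c *: q -> nuP v p = v c.
Proof.
by move=> c0 Hq ->; rewrite nuPZ ?prim_neq0 // nuP_prim // addr0.
Qed.

Lemma prim_scale (p : {poly K}) : p != 0 -> prim (pi ^ (- nuP v p) *: p).
Proof.
move=> p0; apply: prim_nuP; first by rewrite scaler_eq0 negb_or pi_neq0.
by rewrite nuPZ ?pi_neq0 // vpi addNr.
Qed.

Lemma primM (p q : {poly K}) : prim p -> prim q -> prim (p * q).
Proof.
move=> [Op rp0] [Oq rq0]; split; first exact: OPM.
by rewrite rpM // mulf_neq0.
Qed.

(** Gauss's lemma: once both factors are scaled to primitive ones, the product of their reductions
    is nonzero because [{poly k}] is a domain. *)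
Lemma nuPM (p q : {poly K}) : p != 0 -> q != 0 -> nuP v (p * q) = nuP v p + nuP v q.
Proof.
move=> p0 q0; have Hpq := primM (prim_scale p0) (prim_scale q0).
have := nuP_prim Hpq; rewrite -scalerAl -scalerAr scalerA nuPZ ?mulf_neq0 ?pi_neq0 //.
rewrite vM ?pi_neq0 // !vpi.
by move: (nuP v p) (nuP v q) (nuP v (p * q)); lia.
Qed.

Lemma OP_divl (p q : {poly K}) : prim p -> OP (p * q) -> OP q.
Proof.
move=> Hp Opq; have p0 := prim_neq0 Hp.
have [->|q0] := eqVneq q 0; first by move=> i; rewrite coef0 inO0.
apply/OP_nuP => //; have := (OP_nuP (mulf_neq0 p0 q0)).1 Opq.
by rewrite nuPM // nuP_prim // add0r.
Qed.

End Valuation.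

(** * Reduction of the expansion *)

Section ReductionOfExpansion.
Variables (K k : fieldType) (v : K -> int) (pi : K) (red : K -> k).
Hypothesis HK : dvr v pi.
Hypothesis Hred : residue v red.
Hypothesis two_k : (2%:R : k) != 0.

Lemma inO2 : inO v 2%:R.
Proof. by rewrite mulr2n; apply: (inOD HK); exact: (inO1 HK). Qed.

Lemma red2 : red 2%:R = 2%:R.
Proof. by rewrite !mulr2n (redD Hred) ?(inO1 HK) // (red_1 Hred). Qed.

Lemma two_K : (2%:R : K) != 0 /\ v 2%:R = 0.
Proof. by apply: (red_neq0 Hred inO2); rewrite red2. Qed.

Let two_K0 := proj1 two_K.
Let v2 := proj2 two_K.

Variables (A D : {poly K}) (a s : nat -> {poly K}) (t : nat -> K).
Hypothesis H : quad_cf A D a s t.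
Hypothesis vA2 : v A`_2 = 0.

(** The leading coefficient of [a n.+1 * s n.+1] is that of [2 A], a unit. *)
Lemma lead_a n : v (lead_coef (a n.+1)) = - v (lead_coef (s n.+1)).
Proof.
have := congr1 (fun p => lead_coef p) (qcf_a_s H n).
rewrite /= lead_coefM [lead_coef (_ + _)]lead_coefE (size_twoA two_K0 H) /=.
rewrite coefD coefC addr0 coefMn => E.
have A20 := qcf_A2_neq0 H.
have s0 : lead_coef (s n.+1) != 0 by rewrite lead_coef_eq0 (qcf_s_neq0 H).
have a0 : lead_coef (a n.+1) != 0.
  apply/eqP => a0; move/eqP: E; rewrite a0 mul0r eq_sym -mulr_natl mulf_eq0.
  by rewrite (negPf two_K0) (negPf A20).
move/(congr1 v): E; rewrite (vM HK a0 s0) -mulr_natl (vM HK two_K0 A20) v2 vA2; lia.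
Qed.

Hypothesis OA : OP v A.

Lemma nuP_twoA c : inO v c -> nuP v (A *+ 2 + c%:P) = 0.
Proof.
move=> Oc; apply: (nuP_prim Hred); rewrite -scaler_nat; split.
  by apply: (OPD HK); [apply: (OPZ HK) => //; exact: inO2|exact: OPC].
apply/eqP => /(congr1 (fun p : {poly k} => p`_2)) /eqP; rewrite (coef_rp Hred) coef0.
rewrite coefD coefZ coefC addr0 (redM Hred) ?inO2 // red2 mulf_eq0 (negPf two_k) /=.
by apply/negP; apply: (unit_red Hred) => //; exact: (qcf_A2_neq0 H).
Qed.

(** A constant with a pole dominates: divided by [c], the polynomial is integral and reduces to
    [1]. *)
Lemma nuP_twoA_neg c : c != 0 -> v c < 0 -> nuP v (A *+ 2 + c%:P) = v c.
Proof.
move=> c0 vc; apply: (@nuP_scale_prim _ _ _ _ _ HK Hred _ c (c^-1 *: (2%:R *: A) + 1)) => //.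
  have Oc : inO v c^-1 by rewrite inO_vge /vge (vV HK) //; apply/orP; right; lia.
  have O2A : OP v (2%:R *: A) by apply: (OPZ HK) => //; exact: inO2.
  have O1 : OP v 1 by apply: OPC; exact: (inO1 HK).
  have Oc2A : OP v (c^-1 *: (2%:R *: A)) by apply: (OPZ HK).
  split; first exact: (OPD HK).
  rewrite (rpD Hred) // (rpZ Hred) // (_ : red c^-1 = 0).
    by rewrite scale0r add0r (_ : 1 = 1%:P) // (rpC Hred) (red_1 Hred) oner_neq0.
  by apply/eqP; rewrite (red_pos Hred) // /vge (vV HK) //; apply/orP; right; lia.
by rewrite scalerDr scalerA mulfV // scale1r scaler_nat alg_polyC.
Qed.

Hypothesis OD : OP v D.
Hypothesis s_linear : forall n, size (s n.+1) = 2%N.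
Variables (ab sb : nat -> {poly k}) (tb : nat -> k) (l : nat).
Hypothesis Hb : quad_cf (rp red A) (rp red D) ab sb tb.
Hypothesis l_gt0 : (0 < l)%N.
Hypothesis sb_l : size (sb l) = 1%N.
Hypothesis sb_lin : forall i, (0 < i < l)%N -> size (sb i) = 2%N.

(* Turns out to be the [f n] of the theorem. *)
Definition gap n : int :=
  if (n %% l.+1 == l)%N then v (s n)`_1 - nuP v (s n) else 0.

Lemma gap_eq0 n : (n %% l.+1 != l)%N -> gap n = 0.
Proof. by rewrite /gap => /negPf->. Qed.

Lemma modS n : (n.+1 %% l.+1 = if n %% l.+1 == l then 0 else (n %% l.+1).+1)%N.
Proof.
have := ltn_pmod n (ltn0Sn l); rewrite ltnS leq_eqVlt -(addn1 n) -(modnDml n) addn1.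
case: eqP => [-> _|_ /= lt]; first by rewrite modnn.
by rewrite modn_small.
Qed.

(** The scalar makes [s n] primitive. Indices are taken modulo [l + 1] and not [l]: a block ends at
    the constant [sb l], and the next index starts again from [sb 0]. *)
Definition reduces_to n (c : K) :=
  [/\ c != 0, OP v (c *: s n) & rp red (c *: s n) = sb (n %% l.+1)%N].

Lemma s1_neq0 n : (s n.+1)`_1 != 0.
Proof.
have -> : (s n.+1)`_1 = lead_coef (s n.+1) by rewrite lead_coefE s_linear.
by rewrite lead_coef_eq0 (qcf_s_neq0 H).
Qed.

Lemma reduces_prim n c : reduces_to n c -> prim v red (c *: s n).
Proof. by case=> c0 Os Es; split=> //; rewrite Es (qcf_s_neq0 Hb). Qed.

Lemma reduces_nuP n c : reduces_to n c -> nuP v (s n) = - v c.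
Proof.
move=> Hc; have := nuP_prim Hred (reduces_prim Hc); case: Hc => c0 _ _.
by rewrite (nuPZ HK) ?(qcf_s_neq0 H) // => /eqP; rewrite addrC addr_eq0 => /eqP.
Qed.

Lemma reduces_coef_unit n c i : reduces_to n c -> (sb (n %% l.+1)%N)`_i != 0 ->
  (s n)`_i != 0 /\ v (s n)`_i = nuP v (s n).
Proof.
move=> Hc; rewrite (reduces_nuP Hc); case: Hc => c0 Os <-; rewrite (coef_rp Hred).
move/(red_neq0 Hred (Os i)); rewrite coefZ mulf_eq0 negb_or => -[/andP[_ si0]].
by rewrite (vM HK) // => /eqP; rewrite addrC addr_eq0 => /eqP E; split.
Qed.

Lemma sb_coef0 n : size (sb n) = 1%N -> (sb n)`_0 != 0.
Proof. by move/(size1_scale1 Hb) => []. Qed.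

(** The reduction [sb l] is constant, so the [X] coefficient of the primitive multiple of [s n.+1]
    lies in the maximal ideal; it is nonzero because [s n.+1] is linear over [K]. *)
Lemma gap_gt0 n c : reduces_to n.+1 c -> (n.+1 %% l.+1 = l)%N -> 0 < gap n.+1.
Proof.
move=> Hc El; rewrite /gap El eqxx (reduces_nuP Hc); case: Hc => c0 Os Es.
have : vge v (c * (s n.+1)`_1) 1.
  rewrite -coefZ -(red_pos Hred) // -(coef_rp Hred) Es El nth_default ?eqxx //.
  by rewrite sb_l.
rewrite (vgeE v 1 (mulf_neq0 c0 (s1_neq0 n))) (vM HK c0 (s1_neq0 n)); lia.
Qed.

Let z n : K := - (s n)`_0 / (s n)`_1.

Lemma root_z n : root (s n.+1) (z n.+1).
Proof.
rewrite rootE horner_coef s_linear !big_ord_recl big_ord0 /= /bump /= /z.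
by have := s1_neq0 n => ?; apply/eqP; field.
Qed.

Lemma t_next n : t n.+2 = - (2%:R * A.[z n.+1] + t n.+1).
Proof.
apply/eqP; rewrite -addr_eq0 addrC; apply/eqP.
exact: (qcf_t_root H (root_z n)).
Qed.

(** At the root of [s n.+1] the product formula reads [t (t + 2 A(z)) = R(z)] with [R = s 1], and
    the second factor is [- t n.+2]. *)
Lemma t_t_next n : t n.+1 * t n.+2 = - (s 1%N).[z n.+1].
Proof.
have := congr1 (fun p => p.[z n.+1]) (qcf_s_s H n).
rewrite hornerM (rootP (root_z n)) mulr0 (qcf_s1 H) !hornerE => /esym/eqP.
rewrite subr_eq0 => /eqP ->; rewrite t_next; ring.
Qed.

(** * One step of the expansion modulo the maximal ideal *)

Lemma v_z n e : (s n.+1)`_0 != 0 -> v (s n.+1)`_1 = v (s n.+1)`_0 + e ->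
  z n.+1 != 0 /\ v (z n.+1) = - e.
Proof.
move=> s0 E; split; first by rewrite mulf_neq0 ?oppr_eq0 ?invr_eq0 ?s1_neq0.
by rewrite (vM HK) ?oppr_eq0 ?invr_eq0 ?s1_neq0 // (vN HK) (vV HK) ?s1_neq0 // E; lia.
Qed.

Lemma OPs1 : OP v (s 1%N).
Proof. by rewrite (qcf_s1 H); apply: (OPB HK) => //; apply: (OPM HK). Qed.

(** The right side of the product formula is integral and reduces to its analogue over [k]. Division
    by the primitive [c *: s n] keeps integrality, and over [k] the factor [sb] can be cancelled. *)
Lemma norm_step_integral n c : (n %% l.+1 < l)%N -> reduces_to n c ->
  inO v (t n.+1) -> red (t n.+1) = tb (n %% l.+1).+1 -> reduces_to n.+1 c^-1.
Proof.
move=> lt Hc Ot Et; have [c0 Os Es] := Hc.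
have prod : (c *: s n) * (c^-1 *: s n.+1) = D - (A + (t n.+1)%:P) ^+ 2.
  by rewrite -scalerAl -scalerAr scalerA mulfV // scale1r (qcf_s_s H).
have OAt : OP v (A + (t n.+1)%:P) by apply: (OPD HK) => //; apply: OPC.
have OAt2 : OP v ((A + (t n.+1)%:P) ^+ 2) by rewrite expr2; apply: (OPM HK).
have OE : OP v ((c *: s n) * (c^-1 *: s n.+1)) by rewrite prod; apply: (OPB HK).
have Os' := OP_divl HK Hred (reduces_prim Hc) OE.
split=> //; first by rewrite invr_eq0.
rewrite modS ltn_eqF //; apply: (mulfI (qcf_s_neq0 Hb (n %% l.+1)%N)).
rewrite -{1}Es -(rpM HK Hred) // prod (rpB HK Hred) // expr2 (rpM HK Hred) //.
by rewrite (rpD Hred) ?(rpC Hred) ?Et ?(qcf_s_s Hb) //; apply: OPC.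
Qed.

(** As [sb] is linear here, the leading coefficient of the scaled [s n.+1] is a unit; its root is
    integral and reduces to the root over [k], which determines the next [tb]. *)
Lemma t_step_regular n c : (0 < n.+1 %% l.+1 < l)%N -> reduces_to n.+1 c ->
  inO v (t n.+1) -> red (t n.+1) = tb (n.+1 %% l.+1)%N ->
  inO v (t n.+2) /\ red (t n.+2) = tb (n.+1 %% l.+1).+1.
Proof.
move=> /andP[i0 il] Hc Ot Et.
have sb1 : (sb (n.+1 %% l.+1)%N)`_1 != 0.
  have sz := sb_lin (introT andP (conj i0 il)).
  have -> : (sb (n.+1 %% l.+1)%N)`_1 = lead_coef (sb (n.+1 %% l.+1)%N).
    by rewrite lead_coefE sz.
  by rewrite lead_coef_eq0 (qcf_s_neq0 Hb).
have [s1 vs1] := reduces_coef_unit Hc sb1.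
have Oz : inO v (z n.+1).
  rewrite inO_vge; have := vgeM HK (nuP_vge v (s n.+1) 0) (vge_refl v ((s n.+1)`_1)^-1).
  by rewrite (vV HK) // vs1 subrr /z mulNr (vgeN HK).
have [OAz EAz] := OP_horner HK Hred OA Oz.
have O2Az : inO v (2%:R * A.[z n.+1]) by apply: (inOM HK) => //; exact: inO2.
rewrite t_next; split; first by apply: (inON HK); apply: (inOD HK).
have rz : root (sb (n.+1 %% l.+1)%N) (red (z n.+1)).
  case: Hc => c0 Os <-; rewrite rootE -(OP_horner HK Hred Os Oz).2 hornerZ.
  by rewrite (rootP (root_z n)) mulr0 (red0 Hred).
rewrite (redN HK Hred) ?(inOD HK) // (redD Hred) // (redM Hred) ?inO2 // red2 EAz Et.
move: rz; case: (n.+1 %% l.+1)%N i0 => // i _ rz.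
apply/eqP; rewrite eq_sym -addr_eq0 addrC; apply/eqP.
exact: (qcf_t_root Hb rz).
Qed.

(** The root has a pole of order [e], so [R(z)] has one of order at most [e]. Dividing by [t n.+1],
    with its pole of order [2 e], leaves valuation at least [e > 0], in accordance with
    [tb 1 = 0]. *)
Lemma t_step_exit n e c : (n.+1 %% l.+1 = 0)%N -> reduces_to n.+1 c -> 0 < e ->
  t n.+1 != 0 -> v (t n.+1) = - (2 * e) -> v (s n.+1)`_1 = nuP v (s n.+1) + e ->
  inO v (t n.+2) /\ red (t n.+2) = tb 1%N.
Proof.
move=> E0 Hc e0 t0 vt vs1.
have [s00 vs0] : (s n.+1)`_0 != 0 /\ v (s n.+1)`_0 = nuP v (s n.+1).
  by apply: (reduces_coef_unit Hc); rewrite E0 (qcf_s0 Hb) coefC eqxx oner_neq0.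
have [z0 vz] : z n.+1 != 0 /\ v (z n.+1) = - e by apply: v_z => //; rewrite vs0.
have Hs1 : vge v (s 1%N).[z n.+1] (- e).
  rewrite horner_coef s_linear !big_ord_recl big_ord0 /= addr0 expr0 mulr1 /bump /= expr1.
  apply: (vgeD HK); first by apply: vgeW (OPs1 0%N); lia.
  by rewrite -[- e]add0r; apply: (vgeM HK); [exact: OPs1|rewrite -vz vge_refl].
have tge : vge v (t n.+2) e.
  have -> : t n.+2 = - (s 1%N).[z n.+1] * (t n.+1)^-1.
    by rewrite -t_t_next mulrAC mulfV // mul1r.
  rewrite (_ : e = - e + 2 * e); last by lia.
  apply: (vgeM HK); first by rewrite (vgeN HK).
  by rewrite (_ : 2 * e = v (t n.+1)^-1) ?vge_refl // (vV HK) // vt opprK.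
have Ot : inO v (t n.+2) by apply: vgeW tge; lia.
split=> //; rewrite (qcf_t1 Hb); apply/eqP; rewrite (red_pos Hred) //.
by apply: vgeW tge; lia.
Qed.

(** The root has a pole of order [e], and in [2 A(z) + t n.+1] the term [x = 2 A_2 z ^ 2] dominates
    the remainder [y], whose pole has order at most [e]. *)
Lemma t_step_enter n e c : (n.+1 %% l.+1 = l)%N -> reduces_to n.+1 c -> 0 < e ->
  inO v (t n.+1) -> v (s n.+1)`_1 = nuP v (s n.+1) + e ->
  t n.+2 != 0 /\ v (t n.+2) = - (2 * e).
Proof.
move=> El Hc e0 Ot vs1.
have [s00 vs0] : (s n.+1)`_0 != 0 /\ v (s n.+1)`_0 = nuP v (s n.+1).
  by apply: (reduces_coef_unit Hc); rewrite El sb_coef0.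
have [z0 vz] : z n.+1 != 0 /\ v (z n.+1) = - e by apply: v_z => //; rewrite vs0.
have A20 := qcf_A2_neq0 H.
pose x := 2%:R * (A`_2 * (z n.+1 * z n.+1)).
have x0 : x != 0 := mulf_neq0 two_K0 (mulf_neq0 A20 (mulf_neq0 z0 z0)).
have vx : v x = - (2 * e).
  rewrite (vM HK two_K0 (mulf_neq0 A20 (mulf_neq0 z0 z0))) (vM HK A20 (mulf_neq0 z0 z0)).
  by rewrite (vM HK z0 z0) v2 vA2 vz; lia.
pose y := 2%:R * (A`_0 + A`_1 * z n.+1) + t n.+1.
have Hy : vge v y (- e).
  apply: (vgeD HK); last by apply: vgeW Ot; lia.
  rewrite -[- e]add0r; apply: (vgeM HK inO2); apply: (vgeD HK).
    by apply: vgeW (OA 0%N); lia.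
  by rewrite -[- e]add0r; apply: (vgeM HK); [exact: OA|rewrite -vz vge_refl].
have Hy' : vge v y (v x + 1) by apply: vgeW Hy; rewrite vx; lia.
have [xy0 vxy] := vD_lt HK x0 Hy'.
have -> : t n.+2 = - (x + y).
  rewrite t_next horner_coef (qcf_size_A H) !big_ord_recl big_ord0 /= /bump /= /x /y.
  by ring.
by rewrite oppr_eq0 (vN HK) vxy vx.
Qed.

(** In the product formula [- t ^ 2] dominates: the right side is [T ^ 2] times an integral [E]
    reducing to [-1]. So the Gauss valuations add up to [- 4 e], and [s n.+1] is, after scaling,
    constant modulo the maximal ideal. *)
Lemma norm_step_enter n e c : (n %% l.+1 = l)%N -> reduces_to n c -> 0 < e ->
  t n.+1 != 0 -> v (t n.+1) = - (2 * e) ->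
  (exists c', reduces_to n.+1 c') /\ nuP v (s n.+1) + nuP v (s n) = - (4 * e).
Proof.
move=> El Hc e0 T0 vT; have [c0 Os Es] := Hc; set T := t n.+1 in T0 vT *.
have OTi : inO v T^-1 by rewrite inO_vge /vge (vV HK) // vT; apply/orP; right; lia.
have rTi : red T^-1 = 0.
  by apply/eqP; rewrite (red_pos Hred) // /vge (vV HK) // vT; apply/orP; right; lia.
pose E := T^-1 *: (T^-1 *: s 1%N - (2%:R *: A)) - 1.
have EE : s n * s n.+1 = T ^+ 2 *: E.
  rewrite (qcf_s_s H) -/T /E (qcf_s1 H) -!mul_polyC.
  have ET : T%:P * (T^-1)%:P = 1 :> {poly K} by rewrite -polyCM mulfV.
  rewrite expr2 polyCM.
  transitivity ((T%:P * (T^-1)%:P) * ((T%:P * (T^-1)%:P) * (D - A ^+ 2)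
    - T%:P * (2%:R%:P * A)) - T%:P * T%:P).
    by rewrite ET polyC_natr; ring.
  by ring.
have O1 : OP v 1 by apply: OPC; exact: (inO1 HK).
have O2A : OP v (2%:R *: A) by apply: (OPZ HK) => //; exact: inO2.
have OTs : OP v (T^-1 *: s 1%N) by apply: (OPZ HK) => //; exact: OPs1.
have OB : OP v (T^-1 *: s 1%N - 2%:R *: A) by apply: (OPB HK).
have OE : OP v E by apply: (OPB HK) => //; apply: (OPZ HK).
have rE : rp red E = -1.
  rewrite (rpB HK Hred) //; last exact: (OPZ HK).
  rewrite (rpZ Hred) // rTi scale0r sub0r (_ : 1 = 1%:P) // (rpC Hred) (red_1 Hred).
  by [].
have pE : prim v red E by split=> //; rewrite rE oppr_eq0 oner_eq0.
split; last first.
  rewrite addrC -(nuPM HK Hred) ?(qcf_s_neq0 H) // (nuP_scale_prim HK Hred _ pE EE).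
    by rewrite (vXn HK) // vT; lia.
  by rewrite expf_neq0.
pose p := (T ^- 2 * c^-1) *: s n.+1.
have Ep : (c *: s n) * p = E.
  rewrite /p -scalerAl -scalerAr scalerA EE scalerA (_ : _ * _ = 1) ?scale1r //.
  by field; rewrite T0 c0.
have Op : OP v p by apply: (OP_divl HK Hred (reduces_prim Hc)); rewrite Ep.
have [Esb d0] := size1_scale1 Hb sb_l; set d := (sb l)`_0 in Esb d0.
have rpp : d *: rp red p = -1.
  rewrite -rE -Ep (rpM HK Hred) // Es El Esb (qcf_s0 Hb).
  by rewrite -scalerAl mul1r.
(* The lift [u] of [- d] normalises the constant reduction of [p] to [sb 0 = 1]. *)
have [u [Ou Eu]] := red_surj Hred (- d).
have [u0 _] : u != 0 /\ v u = 0 by apply: (red_neq0 Hred) => //; rewrite Eu oppr_eq0.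
exists (u * (T ^- 2 * c^-1)); split.
- by rewrite !mulf_neq0 ?invr_eq0 // expf_neq0.
- by rewrite -scalerA; apply: (OPZ HK).
- rewrite -scalerA (rpZ Hred) // Eu scaleNr rpp opprK.
  by rewrite modS El eqxx (qcf_s0 Hb).
Qed.

(** The induction hypothesis: [t n] follows the expansion over [k] except at positive multiples of
    [l + 1], where it has a pole of order twice the preceding gap. The last clause carries the
    valuations through the pole. *)
Definition block_inv n :=
  [/\ ((n %% l.+1 != 0)%N -> inO v (t n) /\ red (t n) = tb (n %% l.+1)%N),
      (n %% l.+1 = 0)%N -> (0 < n)%N ->
        [/\ t n != 0, v (t n) = - (2 * gap n.-1) & 0 < gap n.-1],
      exists c, reduces_to n c &
      (0 < n)%N -> v (s n)`_1 = nuP v (s n) + gap n + gap n.-1 /\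
                   nuP v (s n) + nuP v (s n.-1) = - (4 * gap n.-1)].

Lemma block_invP n : block_inv n.
Proof.
elim: n => [|n [IHa IHb [c Hc] IHd]].
  rewrite /block_inv mod0n; split=> //; exists 1; split; first exact: oner_neq0.
    by rewrite scale1r (qcf_s0 H); apply: OPC; exact: (inO1 HK).
  by rewrite scale1r (qcf_s0 H) mod0n (qcf_s0 Hb) (_ : 1 = 1%:P) // (rpC Hred) (red_1 Hred).
have lel : (n %% l.+1 <= l)%N by rewrite -ltnS ltn_pmod.
have [El|neql] := eqVneq (n %% l.+1)%N l.
  have n0 : (0 < n)%N by case: n El {IHa IHb Hc IHd lel} => //; rewrite mod0n; lia.
  have gn0 : gap n.-1 = 0.
    apply: gap_eq0; apply/eqP => E; have := modS n.-1; rewrite prednK // El E eqxx.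
    by lia.
  have g0 : 0 < gap n by case: n n0 Hc El {IHa IHb IHd lel gn0} => // n _; exact: gap_gt0.
  have [Ht _] : inO v (t n) /\ red (t n) = tb (n %% l.+1)%N.
    by apply: IHa; rewrite El -lt0n.
  have [vs1 _] := IHd n0; rewrite gn0 addr0 in vs1.
  have [T0 vT] : t n.+1 != 0 /\ v (t n.+1) = - (2 * gap n).
    case: n n0 El Hc g0 Ht vs1 {IHa IHb IHd lel gn0} => // n _ El Hc g0 Ht vs1.
    exact: (t_step_enter El Hc).
  have [[c' Hc'] En] := norm_step_enter El Hc g0 T0 vT.
  have gS : gap n.+1 = 0 by apply: gap_eq0; rewrite modS El eqxx; lia.
  split; rewrite ?modS ?El ?eqxx //=; first by exists c'.
  move=> _; split=> //; rewrite gS addr0.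
  have sn2 : size (s n) = 2%N by rewrite -(prednK n0) s_linear.
  have s1 : (s n)`_1 != 0 by rewrite -(prednK n0) s1_neq0.
  (* The [X^2] coefficient [- 2 t A_2] of [s n * s n.+1] gives the valuation of the leading
     coefficient of [s n.+1]. *)
  have := qcf_s_s_coef2 H n.
  have -> : (s n * s n.+1)`_2 = (s n)`_1 * (s n.+1)`_1.
    by rewrite coefM !big_ord_recl big_ord0 /= /bump /= (nth_default _ (_ : size (s n) <= 2)%N)
      ?sn2 // (nth_default _ (_ : size (s n.+1) <= 2)%N) ?s_linear // mulr0 mul0r !addr0 add0r.
  move/(congr1 v); rewrite (vM HK s1 (s1_neq0 n)) (vN HK).
  rewrite (vM HK (mulf_neq0 two_K0 T0) (qcf_A2_neq0 H)) (vM HK two_K0 T0) v2 vA2 vT vs1.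
  move: En; clear; move: (nuP v (s n.+1)) (nuP v (s n)) (gap n) (v (s n.+1)`_1); lia.
have lt : (n %% l.+1 < l)%N by rewrite ltn_neqAle neql.
have gn : gap n = 0 by exact: gap_eq0.
have [Ot Et] : inO v (t n.+1) /\ red (t n.+1) = tb (n %% l.+1).+1.
  case: n IHa IHb Hc IHd lel neql lt gn => [|n] IHa IHb Hc IHd lel neql lt gn.
    (* The first step is separate because [t 0] is junk: both [t 1] and [tb 1] are zero. *)
    by rewrite mod0n (qcf_t1 H) (qcf_t1 Hb) (red0 Hred) (inO0 v).
  have [E0|i0] := eqVneq (n.+1 %% l.+1)%N 0%N.
    have [t0 vt g0] := IHb E0 isT; have [vs1 _] := IHd isT.
    rewrite gn addr0 in vs1; rewrite E0; exact: (t_step_exit E0 Hc g0).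
  have [Ot Et] := IHa i0; apply: (t_step_regular _ Hc) => //.
  by rewrite lt0n i0.
have Hc' := norm_step_integral lt Hc Ot Et.
have Em : (n.+1 %% l.+1 = (n %% l.+1).+1)%N by rewrite modS (negPf neql).
split; rewrite ?Em //; first by exists c^-1.
move=> _ /=; rewrite gn mulr0 addr0 (reduces_nuP Hc) (reduces_nuP Hc').
have [c0 _ _] := Hc; rewrite (vV HK c0) opprK subrr oppr0; split=> //.
rewrite /gap Em; case: eqP => [_|neq].
  by rewrite (reduces_nuP Hc') (vV HK c0) opprK addrC subrK.
have sz : size (sb (n %% l.+1).+1) = 2%N by apply: sb_lin; rewrite /=; lia.
have sb1 : (sb (n.+1 %% l.+1)%N)`_1 != 0.
  have -> : (sb (n.+1 %% l.+1)%N)`_1 = lead_coef (sb (n.+1 %% l.+1)%N).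
    by rewrite lead_coefE Em sz.
  by rewrite lead_coef_eq0 (qcf_s_neq0 Hb).
by have [_ ->] := reduces_coef_unit Hc' sb1; rewrite (reduces_nuP Hc') (vV HK c0) opprK addr0.
Qed.

(** * Valuations of the [s n] and [a n] *)

Lemma gap_ge0 n : 0 <= gap n.
Proof.
have [El|neql] := eqVneq (n %% l.+1)%N l; last by rewrite gap_eq0.
case: n El => [|n] El; first by move: El l_gt0; rewrite mod0n => <-.
by have [_ _ [c Hc] _] := block_invP n.+1; apply/ltW/(gap_gt0 Hc).
Qed.

Lemma gap_pos n : (n %% l.+1 = l)%N <-> 0 < gap n.
Proof.
split=> [|]; last first.
  by move=> g0; apply/eqP; apply: contraTT g0 => /gap_eq0->.
case: n => [|n] El; first by move: El l_gt0; rewrite mod0n => <-.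
by have [_ _ [c Hc] _] := block_invP n.+1; apply: gap_gt0 Hc El.
Qed.

Lemma lead_s n : v (lead_coef (s n.+1)) = nuP v (s n.+1) + gap n.+1 + gap n.
Proof.
have [_ _ _ /(_ isT)[<- _]] := block_invP n.+1.
by rewrite lead_coefE s_linear.
Qed.

Lemma nuP_s n : nuP v (s n.+1) + nuP v (s n) = - (4 * gap n).
Proof. by have [_ _ _ /(_ isT)[_ ->]] := block_invP n.+1. Qed.

Lemma nuP_a n : nuP v (a n.+1) = - nuP v (s n.+1) - 2 * gap n.+1 - 2 * gap n.
Proof.
(* At most one of [t n.+1] and [t n.+2] has a pole, as [l > 0]; if one has, it determines the
   valuation, and otherwise [2 A] gives valuation [0]. *)
suff E : nuP v (A *+ 2 + (t n.+1 + t n.+2)%:P) = - (2 * gap n.+1) - 2 * gap n.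
  have a0 : a n.+1 != 0.
    apply/eqP => a0; have := qcf_a_s H n; rewrite a0 mul0r => /esym/eqP.
    by rewrite -size_poly_eq0 (size_twoA two_K0 H).
  have := nuPM HK Hred a0 (qcf_s_neq0 H n.+1); rewrite (qcf_a_s H) E; lia.
have [Ha Hbl _ _] := block_invP n.+1; have [Ha' Hb' _ _] := block_invP n.+2.
have [El|neql] := eqVneq (n.+1 %% l.+1)%N l.
  have E2 : (n.+2 %% l.+1 = 0)%N by rewrite modS El eqxx.
  have [t0 vt g0] := Hb' E2 isT; rewrite /= in vt g0.
  have [Ot _] : inO v (t n.+1) /\ red (t n.+1) = tb (n.+1 %% l.+1)%N.
    by apply: Ha; rewrite El -lt0n.
  have gn : gap n = 0.
    by apply: gap_eq0; apply/eqP => E; have := modS n; rewrite El E eqxx; lia.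
  have Ht : vge v (t n.+1) (v (t n.+2) + 1) by apply: vgeW Ot; lia.
  have [tt0 vtt] := vD_lt HK t0 Ht; rewrite addrC in tt0 vtt.
  by rewrite nuP_twoA_neg // vtt vt ?gn ?mulr0 ?subr0 //; lia.
have E2 : (n.+2 %% l.+1)%N = (n.+1 %% l.+1).+1 by rewrite modS (negPf neql).
have [Ot' _] : inO v (t n.+2) /\ red (t n.+2) = tb (n.+2 %% l.+1)%N by apply: Ha'; rewrite E2.
rewrite (gap_eq0 neql).
have [E0|n0] := eqVneq (n.+1 %% l.+1)%N 0%N.
  have [t0 vt g0] := Hbl E0 isT; rewrite /= in vt g0.
  have Ht : vge v (t n.+2) (v (t n.+1) + 1) by apply: vgeW Ot'; lia.
  have [tt0 vtt] := vD_lt HK t0 Ht.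
  by rewrite nuP_twoA_neg // vtt vt ?mulr0 ?oppr0 ?sub0r //; lia.
have [Ot _] := Ha n0.
rewrite nuP_twoA; last exact: (inOD HK).
rewrite (@gap_eq0 n) ?mulr0 ?subr0 //.
by apply: contra n0 => /eqP E; rewrite modS E eqxx.
Qed.

End ReductionOfExpansion.

(** * Valuations of the convergents and complete quotients *)

(** Serves both for the expansion over [K] and for the one over [k]. *)
Lemma quad_cf_of_cf (F : fieldType) (D : {poly F}) (sD : lser F)
    (al : nat -> lser F) (a : nat -> {poly F}) :
  (2%:R : F) != 0 -> size D = 5%N -> sD * sD = pser D -> al 0%N = sD ->
  (forall n (i : nat), (a n)`_i = al n i%:Z) ->
  (forall n, (al n - pser (a n)) * al n.+1 = 1) ->
  quad_cf (a 0%N) D a (cq_s D a) (cq_t D a).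
Proof.
move=> two0 szD sqD al0 fl st; split.
- exact: (size_A sqD al0 fl szD).
- by [].
- exact: (cq_s_neq0 sqD al0 fl st).
- exact: (size_s sqD al0 fl st szD two0).
- exact: (cq_a_s sqD al0 fl st szD two0).
- exact: (cq_s_s sqD al0 fl st szD two0).
- exact: (cq_t_const sqD al0 fl st szD two0).
Qed.

Lemma is_cf_ser (F : fieldType) (x : laurent F) al a : is_cf x al a ->
  [/\ ls (al 0%N) = ls x, forall n (i : nat), (a n)`_i = ls (al n) i%:Z &
      forall n, (ls (al n) - pser (a n)) * ls (al n.+1) = 1].
Proof.
move=> [/leqL_ls E0 Hs]; split=> // n; have [Ea /leqL_ls Es] := Hs n.
  by move=> i; rewrite Ea lfloorE.
by rewrite -ls_lone -Es ls_lmul ls_lsub ls_lpoly.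
Qed.

Lemma pser_linear_mul (F : fieldType) (p : {poly F}) (x : lser F) i :
  size p = 2%N -> (pser p * x) i = p`_1 * x (i - 1) + p`_0 * x i.
Proof.
move=> sz; have Ep : p = (p`_1)%:P * 'X + (p`_0)%:P.
  apply/polyP => -[|[|j]]; rewrite coefD coefCM coefX coefC /= ?mulr0 ?mulr1 ?addr0 ?add0r //.
  by rewrite nth_default // sz.
by rewrite {1}Ep pserD pserM mulrDl serD pserC_mul -mulrA pserC_mul pserX_mul.
Qed.

(** * Series solving linear equations: bounded and unbounded coefficients *)

Section SeriesValuation.
Variables (K k : fieldType) (v : K -> int) (pi : K) (red : K -> k).
Hypothesis HK : dvr v pi.

Lemma vge_serM (x y : lser K) m n : (forall i, vge v (x i) m) ->
  (forall i, vge v (y i) n) -> forall i, vge v ((x * y) i) (m + n).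
Proof.
move=> Hx Hy i; have ltL : bnd x + bnd y - i < (absz (bnd x + bnd y - i)%R).+1%:Z by lia.
rewrite (serM (@bndP _ x) (@bndP _ y) ltL); apply: (vge_sum HK) => j _.
exact: (vgeM HK).
Qed.

(** Solved downwards, the recursion gives [x (i - 1) = (u i - c0 x i) / c1]. The term [c0 x i] has
    negative valuation and dominates the integral [u i], so each step lowers the valuation by
    exactly [e]. *)
Lemma pole_unbounded (c0 c1 : K) (x u : int -> K) e :
  (forall i, c1 * x (i - 1) + c0 * x i = u i) -> (forall i, inO v (u i)) ->
  c0 != 0 -> c1 != 0 -> 0 < e -> v c1 = v c0 + e -> x 1 != 0 -> v (x 1) = - v c1 ->
  forall m : nat, x (1 - m%:Z) != 0 /\ v (x (1 - m%:Z)) = - v c1 - m%:Z * e.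
Proof.
move=> rec Hu c00 c10 e0 vc x1 vx1; elim=> [|m [xm vxm]].
  by rewrite subr0 mul0r subr0.
have E : c1 * x (1 - m.+1%:Z) = - (c0 * x (1 - m%:Z)) + u (1 - m%:Z).
  by rewrite -rec (_ : 1 - m.+1%:Z = 1 - m%:Z - 1); [ring|lia].
have y0 : - (c0 * x (1 - m%:Z)) != 0 by rewrite oppr_eq0 mulf_neq0.
have vy : v (- (c0 * x (1 - m%:Z))) = - (m.+1%:Z * e).
  by rewrite (vN HK) (vM HK c00 xm) vxm vc; lia.
have Hu' : vge v (u (1 - m%:Z)) (v (- (c0 * x (1 - m%:Z))) + 1).
  by apply: vgeW (Hu _); rewrite vy; nia.
have [z0 vz] := vD_lt HK y0 Hu'; rewrite -E vy in z0 vz.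
have x0 : x (1 - m.+1%:Z) != 0 by move: z0; rewrite mulf_eq0 negb_or => /andP[].
by split=> //; move: vz; rewrite (vM HK c10 x0); lia.
Qed.

Lemma integral_root_bounded (c0 c1 : K) (x u : int -> K) :
  (forall i, c1 * x (i - 1) + c0 * x i = u i) -> (forall i, inO v (u i)) ->
  c1 != 0 -> vge v c0 (v c1) -> bounded_by x 1 ->
  forall i, vge v (x i) (- v c1).
Proof.
move=> rec Hu c10 Hc bx i.
case: (ltP 1 i) => [/bx ->|le_i]; first exact: vge0.
have -> : i = 2 - (absz (2 - i)%R)%:Z by lia.
elim: (absz _) => [|m IH]; first by rewrite subr0 bx // vge0.
have -> : x (2 - m.+1%:Z) = (u (2 - m%:Z) - c0 * x (2 - m%:Z)) * c1^-1.
  rewrite -rec (_ : 2 - m.+1%:Z = 2 - m%:Z - 1); last by lia.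
  by field.
rewrite -[- v c1]add0r; apply: (vgeM HK); last by rewrite -(vV HK c10) vge_refl.
apply: (vgeB HK); first exact: Hu.
by have := vgeM HK Hc IH; rewrite subrr.
Qed.

(** Here [x = (w x - S) / t]. As [w] has only negative degrees, a coefficient of [w x] involves only
    coefficients of [x] of higher index, so the bound descends. *)
Lemma unit_const_bounded (t : K) (w x S : lser K) B :
  (w - pser t%:P) * x = S -> t != 0 -> v t <= 0 -> (forall i, inO v (w i)) ->
  bounded_by w (-1) -> bounded_by x 1 -> (forall i, vge v (S i) B) ->
  forall i, vge v (x i) B.
Proof.
move=> E t0 vt Hw bw bx HS i.
suff key (m : nat) : forall j, 2 - m%:Z <= j -> vge v (x j) B.
  by apply: (key (absz (2 - i)%R)); lia.
elim: m => [|m IH] j lej; first by rewrite bx ?vge0 //; lia.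
have [lt|] := ltP (2 - m.+1%:Z) j; first by apply: IH; lia.
move=> gej; have {lej gej} Ej : j = 1 - m%:Z by lia.
have -> : x j = ((w * x) j - S j) * t^-1.
  rewrite -E [(w - _) * x]mulrBl serB pserC_mul; field; exact: t0.
rewrite -[B]addr0; apply: (vgeM HK); last by rewrite /vge (vV HK t0); apply/orP; right; lia.
apply: (vgeB HK) => //.
have ltL : -1 + 1 - j < (absz j).+1%:Z by lia.
rewrite (serM bw bx ltL); apply: (vge_sum HK) => q _.
by rewrite -[B]add0r; apply: (vgeM HK); [exact: Hw|apply: IH; lia].
Qed.

End SeriesValuation.

Lemma inUP l n : inU l n <-> (n %% l.+1 = l)%N.
Proof.
split=> [[j [j0 E]]|E].
  case: j j0 E => // j _ E.
  have -> : n = (j * l.+1 + l)%N by lia.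
  by rewrite modnMDl modn_small.
exists (n %/ l.+1).+1; split=> //; rewrite {1}(divn_eq n l.+1) E; lia.
Qed.

Section ExpansionValuations.
Variables (K k : fieldType) (v : K -> int) (pi : K) (red : K -> k).
Hypothesis HK : dvr v pi.
Hypothesis Hred : residue v red.
Hypothesis two_k : (2%:R : k) != 0.
Variables (D : {poly K}) (sD : lser K) (al : nat -> lser K) (a : nat -> {poly K}).
Hypothesis size_D : size D = 5%N.
Hypothesis OD : OP v D.
Hypothesis vD : v (lead_coef D) = 0.
Hypothesis OsD : forall n, inO v (sD n).
Hypothesis sD_sqr : sD * sD = pser D.
Hypothesis al_0 : al 0%N = sD.
Hypothesis a_floor : forall n (i : nat), (a n)`_i = al n i%:Z.
Hypothesis al_step : forall n, (al n - pser (a n)) * al n.+1 = 1.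
Hypothesis not_periodic : ~ cf_periodic a.
Variables (ab sb : nat -> {poly k}) (tb : nat -> k) (l : nat).
Hypothesis Hb : quad_cf (rp red (a 0%N)) (rp red D) ab sb tb.
Hypothesis Db_not_square : forall p q : {poly k}, q != 0 -> p ^+ 2 != rp red D * q ^+ 2.
Hypothesis l_gt0 : (0 < l)%N.
Hypothesis sb_l : size (sb l) = 1%N.
Hypothesis sb_lin : forall i, (0 < i < l)%N -> size (sb i) = 2%N.

Let s := cq_s D a.
Let t := cq_t D a.
Let A := a 0%N.
Let g := gap v s l.
Let Q n := (cvg a n.+1).2.2.
Let P n := (cvg a n.+1).2.1.

Let two_K0 : (2%:R : K) != 0 := (two_K HK Hred two_k).1.

Let H : quad_cf A D a s t := quad_cf_of_cf two_K0 size_D sD_sqr al_0 a_floor al_step.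

Let s_linear n : size (s n.+1) = 2%N.
Proof.
have [s1|//] := qcf_size_s_cases H n.+1.
by case: not_periodic; apply: (const_periodic two_K0 H (ltn0Sn n)).
Qed.

Let OA : OP v A. Proof. by move=> i; rewrite /A a_floor al_0. Qed.

Let vA2 : v A`_2 = 0.
Proof.
have [_ szA E] := sD_leads sD_sqr al_0 a_floor size_D.
have A20 : A`_2 != 0 := qcf_A2_neq0 H.
have EA : lead_coef A = A`_2 by rewrite lead_coefE szA.
by move/(congr1 v): E; rewrite vD -/A EA (vXn HK) //; lia.
Qed.

Let inv := block_invP HK Hred two_k H vA2 OA OD s_linear Hb l_gt0 sb_l sb_lin.
Let gpos := gap_pos HK Hred two_k H vA2 OA OD s_linear Hb l_gt0 sb_l sb_lin.
Let gge0 := gap_ge0 HK Hred two_k H vA2 OA OD s_linear Hb l_gt0 sb_l sb_lin.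
Let vlead_s := lead_s HK Hred two_k H vA2 OA OD s_linear Hb l_gt0 sb_l sb_lin.
Let nu_s := nuP_s HK Hred two_k H vA2 OA OD s_linear Hb l_gt0 sb_l sb_lin.
Let nu_a := nuP_a HK Hred two_k H vA2 OA OD s_linear Hb l_gt0 sb_l sb_lin.
Let vlead_a := lead_a HK Hred two_k H vA2.

(** * Valuations of the convergents *)

Lemma Q_neq0 n : Q n != 0.
Proof.
rewrite -size_poly_gt0; apply: leq_ltn_trans (size_Q a_floor al_step n).
exact: leq0n.
Qed.

(** With [q_n] scaled to be primitive, the norm [p_n ^ 2 - D q_n ^ 2] is integral with nonzero
    reduction, because the reduction of [D] is not a ratio of squares. That norm is [s n.+1] up to
    sign and the square of the scalar. *)
Lemma nuP_s_q n : nuP v (s n.+1) = 2 * nuP v (Q n).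
Proof.
have Q0 := Q_neq0 n; set nu := nuP v (Q n); pose c := pi ^ (- nu).
have c0 : c != 0 by exact: (pi_neq0 HK).
have vc : v c = - nu by exact: (vpi HK).
have [Oq rq0] : prim v red (c *: Q n) by exact: (prim_scale HK Hred).
(* The error [p_n - sqrt D q_n] has negative degree, so [p_n] is the polynomial part of [sqrt D q_n]
   and inherits integrality from the scaled [q_n]. *)
have Op : OP v (c *: P n).
  move=> i; have [e [[_ _ be] _]] := leads_err al_0 a_floor al_step n.+1.
  have Ei : (P n)`_i = (sD * pser (Q n)) i%:Z.
    apply/eqP; rewrite -subr_eq0 -pserE -serB; apply/eqP/be.
    have := size_Q a_floor al_step n.+1; have := size_Q a_floor al_step n; lia.
  have -> : (c *: P n)`_i = (sD * pser (c *: Q n)) i%:Z.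
    by rewrite coefZ Ei -mul_polyC pserM mulrCA pserC_mul.
  have := @vge_serM _ _ _ HK sD (pser (c *: Q n)) 0 0 OsD; rewrite addr0; apply.
  by case=> j; [rewrite pserE; exact: Oq|rewrite pser_neg // vge0].
have := convergent_norm D a n.+1.
have -> : (cvg a n.+1).2 = (P n, Q n) by rewrite /P /Q; case: (cvg a n.+1).2.
rewrite -/s => En.
have Ec : c ^+ 2 *: ((-1) ^+ n.+1 * s n.+1) = (c *: P n) ^+ 2 - D * (c *: Q n) ^+ 2.
  by rewrite -En -!mul_polyC polyC_exp; ring.
have prim_n : prim v red ((c *: P n) ^+ 2 - D * (c *: Q n) ^+ 2).
  have Op2 : OP v ((c *: P n) ^+ 2) by rewrite expr2; apply: (OPM HK).
  have Oq2 : OP v ((c *: Q n) ^+ 2) by rewrite expr2; apply: (OPM HK).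
  have ODq : OP v (D * (c *: Q n) ^+ 2) by apply: (OPM HK).
  split; first exact: (OPB HK).
  rewrite (rpB HK Hred) // subr_eq0 (rpM HK Hred) // !expr2 !(rpM HK Hred) // -!expr2.
  exact: Db_not_square.
have s0 : s n.+1 != 0 by exact: (qcf_s_neq0 H).
have [u [u0 vu Eu]] : exists u, [/\ u != 0, v u = 0 & (-1) ^+ n.+1 * s n.+1 = u *: s n.+1].
  rewrite -signr_odd; case: (odd _) => /=.
    by exists (-1); rewrite oppr_eq0 oner_neq0 (vN HK) (v1 HK) mulN1r scaleN1r.
  by exists 1; rewrite oner_neq0 (v1 HK) mul1r scale1r.
have c20 : c ^+ 2 != 0 by rewrite expf_neq0.
have := nuP_prim Hred prim_n; rewrite -Ec Eu scalerA (nuPZ HK (mulf_neq0 c20 u0) s0).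
by rewrite (vM HK c20 u0) (vXn HK 2 c0) vu vc; lia.
Qed.

(** The recursion of [Fseq], with the gaps in place of [f]. *)
Fixpoint gsum (n : nat) : int := if n is m.+1 then - (gsum m + g n) else 0.

Lemma g0 : g 0%N = 0.
Proof. by apply: gap_eq0; rewrite mod0n; lia. Qed.

Lemma nuP_s_gsum n : nuP v (s n.+1) = 4 * gsum n.
Proof.
elim: n => [|n IH] /=.
  have := nu_s 0; rewrite -/g g0 (_ : nuP v (s 0%N) = 0); first by lia.
  apply: (nuP_prim Hred); split; first by apply: OPC; exact: (inO1 HK).
  by rewrite (_ : s 0%N = 1%:P) // (rpC Hred) (red_1 Hred) oner_neq0.
by have := nu_s n.+1; rewrite IH -/g; lia.
Qed.

Lemma nuP_q n : nuP v (Q n) = 2 * gsum n.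
Proof. by have := nuP_s_q n; rewrite nuP_s_gsum; lia. Qed.

Lemma vlead_q n : v (lead_coef (Q n)) = 2 * gsum n + g n.
Proof.
elim: n => [|n IH].
  by rewrite g0 /Q /= mulr0 add0r lead_coef1 (v1 HK).
have [EQ _] := lead_Q a_floor al_step n.
have a0 : lead_coef (a n.+1) != 0.
  have := size_a a_floor al_step n; rewrite lead_coef_eq0 -size_poly_gt0; lia.
have q0 : lead_coef (Q n) != 0 by rewrite lead_coef_eq0 Q_neq0.
rewrite {1}/Q EQ (vM HK a0 q0) IH vlead_a vlead_s nuP_s_gsum -/g /=; lia.
Qed.

(** The leading coefficient is [pi ^ (- nu(q_n))] times the inverse, up to sign, of that of
    [q_{n+1}]; its valuation [- 2 F_n - 2 F_{n+1} - g_{n+1}] is [g_{n+1}], since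
    [F_n + F_{n+1} = - g_{n+1}]. This identifies the gaps with the [f_n]. *)
Lemma leads_theta n : exists N c,
  leads (pser (pi ^ (- nuP v (Q n)))%:P * cq_err sD a n.+1) N c /\ v c = g n.+1.
Proof.
have [c [lc Hc]] := leads_err al_0 a_floor al_step n.+1; have [c0 _ _] := lc.
have p0 : pi ^ (- nuP v (Q n)) != 0 by exact: (pi_neq0 HK).
have lp : leads (pser (pi ^ (- nuP v (Q n)))%:P) 0 (pi ^ (- nuP v (Q n))).
  have := @leads_pser _ (pi ^ (- nuP v (Q n)))%:P; rewrite polyC_eq0 size_polyC p0 lead_coefC.
  by apply.
exists (0 - (size (cvg a n.+2).2.2).-1%:Z), (pi ^ (- nuP v (Q n)) * c).
split; first exact: leadsM.
have q0 : lead_coef (Q n.+1) != 0 by rewrite lead_coef_eq0 Q_neq0.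
have vc : v c + v (lead_coef (Q n.+1)) = 0.
  by rewrite -(vM HK c0 q0); case: Hc => E; rewrite /Q E ?(vN HK) (v1 HK).
by rewrite (vM HK p0 c0) (vpi HK) nuP_q; move: vc; rewrite vlead_q /=; lia.
Qed.

(** * Gauss valuations of the complete quotients *)

Lemma al_bounded1 n : bounded_by (al n.+1) 1 /\ al n.+1 1 = lead_coef (a n.+1).
Proof.
have [N _ [[_ E b] sz]] := leads_al a_floor al_step n.
have := qcf_size_a two_K0 H n; rewrite s_linear sz => E4.
by have EN : N = 1%N by [lia]; rewrite EN in E b.
Qed.

Lemma al_rec n i : (s n.+1)`_1 * al n.+1 (i - 1) + (s n.+1)`_0 * al n.+1 i
  = (sD + pser (A + (t n.+1)%:P)) i.
Proof.
rewrite -pser_linear_mul // (cq_al sD_sqr al_0 a_floor al_step).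
by rewrite (cq_rE sD_sqr al_0 a_floor al_step size_D two_K0).
Qed.

Lemma inO_rhs n : inO v (t n) -> forall i, inO v ((sD + pser (A + (t n)%:P)) i).
Proof.
move=> Ot [] i; rewrite serD.
  by rewrite pserE; apply: (inOD HK) => //; apply: (OPD HK) => //; apply: OPC.
by rewrite pser_neg // addr0.
Qed.

Lemma al_unbounded n : (n %% l.+1 = l)%N ->
  forall m : int, exists i, al n i != 0 /\ v (al n i) < m.
Proof.
case: n => [|n] El; first by move: El l_gt0; rewrite mod0n => <-.
have [Ha _ [c Hc] _] := inv n.+1.
have [Ot _] : inO v (t n.+1) /\ red (t n.+1) = tb (n.+1 %% l.+1)%N.
  by apply: Ha; rewrite El -lt0n.
have [c00 vc0] : (s n.+1)`_0 != 0 /\ v (s n.+1)`_0 = nuP v (s n.+1).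
  apply: (reduces_coef_unit HK Hred H Hb Hc); rewrite El.
  by case: (size1_scale1 Hb sb_l).
have gn : gap v s l n = 0.
  apply: gap_eq0; apply/eqP => E; have := modS l n; rewrite El E eqxx; lia.
have e0 : 0 < g n.+1 by apply/gpos.
have Es1 : lead_coef (s n.+1) = (s n.+1)`_1 by rewrite lead_coefE s_linear.
have c10 : (s n.+1)`_1 != 0 by rewrite -Es1 lead_coef_eq0 (qcf_s_neq0 H).
have vc1 : v (s n.+1)`_1 = v (s n.+1)`_0 + g n.+1 by rewrite -Es1 vlead_s gn vc0 addr0.
have [bx x1] := al_bounded1 n.
have x10 : al n.+1 1 != 0.
  have := size_a a_floor al_step n; rewrite x1 lead_coef_eq0 -size_poly_gt0; lia.
have vx1 : v (al n.+1 1) = - v (s n.+1)`_1 by rewrite x1 vlead_a Es1.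
have key := pole_unbounded HK (al_rec n) (inO_rhs Ot) c00 c10 e0 vc1 x10 vx1.
(* Since [g n.+1 >= 1], this many steps push the valuation below [m]. *)
move=> m; pose M := (absz (v (s n.+1)`_1) + absz m + 1)%N.
exists (1 - M%:Z); have [x0 ->] := key M; split=> //.
have : M%:Z <= M%:Z * g n.+1 by rewrite ler_peMr // -gtz0_ge1.
by rewrite /M; move: (v (s n.+1)`_1) (M%:Z * g n.+1); lia.
Qed.

Lemma al_bounded n : (n %% l.+1 != l)%N -> exists B, forall i, vge v (al n i) B.
Proof.
case: n => [|n] neql; first by exists 0 => i; rewrite al_0; exact: OsD.
have [Ha Hz _ _] := inv n.+1; have [bx x1] := al_bounded1 n.
have Es1 : lead_coef (s n.+1) = (s n.+1)`_1 by rewrite lead_coefE s_linear.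
have c10 : (s n.+1)`_1 != 0 by rewrite -Es1 lead_coef_eq0 (qcf_s_neq0 H).
have [E0|n0] := eqVneq (n.+1 %% l.+1)%N 0%N; last first.
  have [Ot _] := Ha n0; exists (- v (s n.+1)`_1).
  apply: (integral_root_bounded HK (al_rec n) (inO_rhs Ot) c10) => //.
  rewrite -Es1 vlead_s !gap_eq0 // ?addr0 ?nuP_vge //.
  by apply: contra n0 => /eqP E; rewrite modS E eqxx.
(* At multiples of [l + 1] the right side of [al_rec] has a pole, so the conjugate equation, with
   [t n.+1] as divisor, takes its place. *)
have [t0 vt gg] := Hz E0 isT; exists (nuP v (s n)).
have E : (sD - pser A - pser (t n.+1)%:P) * al n.+1 = pser (s n).
  rewrite -(cq_al_conj sD_sqr al_0 a_floor al_step).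
  by rewrite (cq_rE sD_sqr al_0 a_floor al_step size_D two_K0) pserD opprD addrA.
apply: (unit_const_bounded HK E t0) => //.
- by rewrite vt; move: gg => /=; lia.
- move=> [] i; rewrite serB; first by rewrite pserE; apply: (inOB HK) => //; exact: OA.
  by rewrite pser_neg // subr0.
- by rewrite -al_0; exact: fracpart_bounded.
- by case=> i; [rewrite pserE nuP_vge|rewrite pser_neg // vge0].
Qed.

Lemma expansion_valuations : exists f F : nat -> int,
  [/\ f 0%N = 0, F 0%N = 0, forall n, F n.+1 = - (F n + f n.+1),
      forall n, 0 <= f n /\ (0 < f n <-> inU l n) &
      forall n, (forall m : int, exists i, al n i != 0 /\ v (al n i) < m) <-> inU l n] /\
  forall n,
    [/\ nuP v (cf_q a n) = 2 * F n, v (lead_coef (cf_q a n)) = 2 * F n + f n,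
        nuP v (a n.+1) = - (4 * F n) - 2 * f n.+1 - 2 * f n,
        v (lead_coef (a n.+1)) = nuP v (a n.+1) + f n.+1 + f n &
        exists N c, leads (pser (pi ^ (- nuP v (cf_q a n)))%:P
          * (pser (cf_p a n) - sD * pser (cf_q a n))) N c /\ v c = f n.+1].
Proof.
exists g, gsum; split; [split=> //|move=> n; split].
- exact: g0.
- by move=> n; split; [exact: gge0|split=> [/gpos/inUP|/inUP/gpos]].
- move=> n; split=> [unb|/inUP/al_unbounded//]; apply/inUP/eqP.
  apply: contraPT unb => /al_bounded[B HB] /(_ B)[i [i0]].
  by have := HB i; rewrite vgeE // leNgt => /negPf->.
- exact: nuP_q.
- exact: vlead_q.
- by rewrite nu_a nuP_s_gsum.
- by rewrite vlead_a vlead_s nu_a -/g; lia.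
- exact: leads_theta.
Qed.

End ExpansionValuations.

(** * Reduction of the square root and conclusion *)

Lemma lmap_red_sqr (K k : fieldType) (v : K -> int) (pi : K) (red : K -> k)
    (D : {poly K}) (sD : laurent K) : dvr v pi -> residue v red ->
  (forall n, inO v (lcoef sD n)) -> ls sD * ls sD = pser D ->
  ls (lmap red sD) * ls (lmap red sD) = pser (rp red D).
Proof.
move=> HK Hred OsD sq.
have lmapE n : ls (lmap red sD) n = red (ls sD n).
  by rewrite /=; case: ifP => // ltn; rewrite ltopP // (red0 Hred).
have b1 : bounded_by (ls sD) (ltop sD) by exact: ltopP.
have b2 : bounded_by (ls (lmap red sD)) (ltop sD).
  by move=> n ltn; rewrite lmapE b1 // (red0 Hred).
apply: lser_eq => n; pose L := (absz (ltop sD + ltop sD - n)%R).+1.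
have ltL : ltop sD + ltop sD - n < L%:Z by rewrite /L; lia.
have -> : pser (rp red D) n = red (pser D n).
  case: n {ltL L} => n; first by rewrite !pserE (coef_rp Hred).
  by rewrite !pser_neg // (red0 Hred).
rewrite -sq (serM b1 b1 ltL) (serM b2 b2 ltL) (red_sum HK Hred) => [|j].
  by apply: eq_bigr => j _; rewrite !lmapE (redM Hred) //; exact: OsD.
by apply: (inOM HK); exact: OsD.
Qed.

Lemma size_rp_unit (K k : fieldType) (v : K -> int) (red : K -> k) (p : {poly K}) :
  residue v red -> p != 0 -> v (lead_coef p) = 0 -> size (rp red p) = size p.
Proof.
move=> Hred p0 vp; apply/eqP; rewrite eqn_leq (size_rp Hred) /=.
have l0 : lead_coef p != 0 by rewrite lead_coef_eq0.
have := unit_red Hred l0 vp; rewrite lead_coefE -(coef_rp Hred) => c0.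
rewrite leqNgt; apply: contra c0 => lt; rewrite nth_default //.
by move: lt; case: (size p).
Qed.

Theorem mainTheorem2 (K k : fieldType) (v : K -> int) (pi : K) (red : K -> k)
  (HK : dvr v pi) (Hred : residue v red) (Hchar : (2%:R : k) != 0)
  (D : {poly K}) (HD4 : size D = 5%N) (HDO : forall i, inO v D`_i)
  (HDlc : v (lead_coef D) = 0) (HDsq : exists c : K, lead_coef D = c ^+ 2)
  (sD : laurent K) (HsDO : forall n, inO v (lcoef sD n))
  (HsD : leqL (lmul sD sD) (lpoly D))
  (l : nat)
  (Hbar : exists (alb : nat -> laurent k) (ab : nat -> {poly k}),
      is_cf (lmap red sD) alb ab /\ cf_periodic ab /\ qperiod_length ab l)
  (al : nat -> laurent K) (a : nat -> {poly K})
  (Hcf : is_cf sD al a) (Hnp : ~ cf_periodic a) :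
  let f := fseq v pi sD a in
  let F := Fseq v pi sD a in
  let q := cf_q a in
  (forall n, nuL_minf v (al n) <-> inU l n) /\
  (forall n, 0 <= f n /\ (0 < f n <-> inU l n)) /\
  (forall n, nuP v (q n) = 2 * F n /\
             v (lead_coef (q n)) = nuP v (q n) + f n) /\
  (forall n, (2 <= n)%N ->
     nuP v (a n) = 2 * (F (n - 2)%N + F n) /\
     v (lead_coef (a n)) = nuP v (a n) + f (n - 1)%N + f n).
Proof.
move=> f F q.
have [alb [ab [Hcfb [_ Hq]]]] := Hbar.
have [E0 fl st] := is_cf_ser Hcf; have [E0b flb stb] := is_cf_ser Hcfb.
have sq : ls sD * ls sD = pser D by rewrite -ls_lmul (proj1 (leqL_ls _ _) HsD) ls_lpoly.
have sqb := lmap_red_sqr HK Hred HsDO sq.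
have D0 : D != 0 by rewrite -size_poly_eq0 HD4.
have szb : size (rp red D) = 5%N by rewrite (size_rp_unit Hred D0 HDlc).
pose alK n := ls (al n); pose alk n := ls (alb n).
have Hb := @quad_cf_of_cf _ _ _ alk ab Hchar szb sqb E0b flb stb.
(* Taking the polynomial part commutes with reduction, so the record over [k] is about the reduction
   of [A]. *)
have EA : ab 0%N = rp red (a 0%N).
  apply/polyP => i; rewrite flb (coef_rp Hred) fl -/alk E0b E0 /=.
  by case: ifP => // lti; rewrite ltopP // (red0 Hred).
rewrite EA in Hb.
have nsq := @not_ratio_square _ _ _ alk ab sqb E0b flb stb.
have [l0 sbl sblin] := qperiod_first_const Hchar Hb Hq.
have [f' [F' [[f0 F0 FS Hf Hal] Hn]]] := @expansion_valuations _ _ _ _ _ HK Hred Hchar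
  D (ls sD) alK a HD4 HDO HDlc HsDO sq E0 fl st Hnp _ _ _ _ Hb nsq l0 sbl sblin.
(* The gaps equal the given [f n]: at [0] because [theta_{-1} = 1], and afterwards through the
   leading coefficient of [theta]. *)
have Ef n : f n = f' n.
  case: n => [|n]; first by rewrite f0 /f /= (v1 HK).
  have [_ _ _ _ [N [c [Hl vc]]]] := Hn n.
  rewrite -vc -[f n.+1]/(v (lcL (theta v pi sD a n))); congr v.
  apply: (@leads_lcL _ _ N c).
  by rewrite ls_lscale ls_lsub ls_lmul !ls_lpoly.
have EF n : F n = F' n.
  elim: n => [|n IH]; first by rewrite F0.
  by rewrite FS -IH -Ef.
split=> [n|]; first exact: Hal.
split=> [n|]; first by rewrite Ef.
split=> [n|[//|[//|n]] _].
  by rewrite Ef EF; have [nq vq _ _ _] := Hn n; rewrite vq nq.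
have [_ _ na va _] := Hn n.+1; rewrite !Ef !EF va na !subSS !subn0 !FS; split; lia.
Qed.
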